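(* In the setting described in the context, the following three statements are equivalent: (1) Buyer's expected payoff is increasing in the informativeness of Seller's information structure, i.e., whenever an information structure $(X',\pi'^S)$ is more informative than $(X,\pi^S)$ in the sense of Blackwell, Buyer's expected payoff under $(X',\pi'^S)$ is at least as large as under $(X,\pi^S)$. (2) Full revelation to Seller maximizes Buyer's expected payoff among all information structures of Seller. (3) The inverse hazard rate satisfies \[ r(v)r''(v)+r'(v)\le 1 \quad\text{for all } v\in\big(\overline p(q_h),\overline p(q_\ell)\big). \]
   Context: Let $0<q_\ell<q_h<\infty$, $Q=[q_\ell,q_h]$, and let $c$ be a real number with $0<c<q_\ell$. Let $F$ be a probability distribution on $[0,1]$ with support $[0,1]$ admitting a twice continuously differentiable density $f:(0,1)\to\mathbb{R}_{>0}$. Define the inverse hazard rate $r(v)=(1-F(v))/f(v)$ and the virtual valuation $\psi(v)=v-r(v)$ on $(0,1)$, and assume $\psi'(v)>0$ whenever $\psi(v)>0$. For $q\in Q$, $p(q)$ is the unique maximizer over $p\in\mathbb{R}$ of $(p-c)\big(1-F(p/q)\big)$, and $\overline p(q)=p(q)/q$ (one has $0<\overline p(q_h)<\overline p(q_\ell)<1$). Model: the quality $q$ is drawn from a prior $\mu\in\Delta(Q)$ with support $Q$; Buyer's type $v\sim F$ is independent of $q$. Seller's information structure is $(X,\pi^S)$, with $X$ a measurable signal space and $\pi^S:Q\to\Delta(X)$; on observing $x$ Seller forms the Bayesian posterior $\mu^S_x$, and $\mu^S\in\Delta(Q)$ denotes the distribution of Seller's posterior mean $\mathbb{E}_{\mu^S_x}[q]$.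 The distribution $\mu^B$ of Buyer's posterior means is assumed to equal $\mu^S$. Buyer's expected payoff is $\mathbb{E}_{(q,v)\sim\mu^B\times F}[\max\{vq-p(q),0\}]$. Full revelation is the information structure with $X=Q$ and $\pi^S(\cdot\mid q)$ the point mass at $q$. *)

(* Defs.v *)
From HB Require Import structures.
From mathcomp Require Import all_boot all_order all_algebra.
From mathcomp Require Import all_classical all_reals all_analysis.
From mathcomp Require Import measurable_realfun.
Set Implicit Arguments. Unset Strict Implicit. Unset Printing Implicit Defensive.
Import Order.TTheory GRing.Theory Num.Theory.
Import numFieldNormedType.Exports.
Local Open Scope classical_set_scope.
Local Open Scope ring_scope.

Definition dens_cdf (R : realType) (f : R -> R) (v : R) : R :=
  fine (\int[@lebesgue_measure R]_(x in `[0, 1] `&` `]-oo, v]) (f x)%:E).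

Definition inv_hazard (R : realType) (f : R -> R) (v : R) : R :=
  (1 - dens_cdf f v) / f v.

Definition virtual_val (R : realType) (f : R -> R) (v : R) : R :=
  v - inv_hazard f v.

(* Buyer's expected payoff when the (posterior mean) quality is q and Seller
   posts price p(q):  E_{v ~ F} [ max (v q - p q, 0) ]. *)
Definition buyer_util (R : realType) (f : R -> R) (p : R -> R) (q : R) : \bar R :=
  \int[@lebesgue_measure R]_(v in `[0, 1]) (Num.max (v * q - p q) 0 * f v)%:E.

Definition is_info_kernel (R : realType) (d : measure_display)
    (X : measurableType d) (pi : R -> probability X R) : Prop :=
  forall A : set X, measurable A -> measurable_fun [set: R] (pi ^~ A).

(* m : X -> R is (a version of) Seller's posterior mean E[q | x], i.e. the
   conditional expectation of q given the signal x under the joint law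
   mu(dq) pi(q)(dx). *)
Definition is_posterior_mean (R : realType) (d : measure_display)
    (X : measurableType d) (mu : probability R R) (pi : R -> probability X R)
    (m : X -> R) : Prop :=
  measurable_fun setT m /\
  (\int[mu]_q \int[pi q]_x (`|m x|)%:E < +oo)%E /\
  forall A : set X, measurable A ->
    (\int[mu]_q \int[pi q]_(x in A) (m x)%:E
     = \int[mu]_q \int[pi q]_(x in A) q%:E)%E.

(* Buyer's expected payoff E_{(q,v) ~ mu^B x F}[max (v q - p q, 0)] where
   mu^B = mu^S is the law of the posterior mean m(x), x ~ mu(dq) pi(q)(dx). *)
Definition buyer_payoff (R : realType) (d : measure_display)
    (X : measurableType d) (mu : probability R R) (pi : R -> probability X R)
    (m : X -> R) (f : R -> R) (p : R -> R) : \bar R :=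
  (\int[mu]_q \int[pi q]_x buyer_util f p (m x))%E.

Definition more_informative (R : realType) (ql qh : R)
    (d' : measure_display) (X' : measurableType d') (pi' : R -> probability X' R)
    (d : measure_display) (X : measurableType d) (pi : R -> probability X R) : Prop :=
  exists g : X' -> probability X R,
    (forall A : set X, measurable A -> measurable_fun [set: X'] (g ^~ A)) /\
    forall q, q \in `[ql, qh] -> forall A : set X, measurable A ->
      pi q A = (\int[pi' q]_x' g x' A)%E.

Definition full_revelation (R : realType) : R -> probability R R :=
  fun q => (dirac q : probability R R).

(* Main.v *)
Require Import Defs.
From HB Require Import structures.
From mathcomp Require Import all_boot all_order all_algebra.
From mathcomp Require Import all_classical all_reals all_analysis.
From mathcomp Require Import measurable_realfun giry.
From mathcomp Require Import ring lra.
Import Order.TTheory GRing.Theory Num.Theory.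
Import numFieldNormedType.Exports.
Local Open Scope classical_set_scope.
Local Open Scope ring_scope.
Set Implicit Arguments. Unset Strict Implicit. Unset Printing Implicit Defensive.

(* Write y = p(q)/q for the normalized price and psi for the virtual valuation.
   The first-order condition of Seller's problem is psi(y) = c/q, and psi is
   increasing where it is positive, so y decreases with q.  Buyer's payoff at q is
   U(q) = q H(y) with H(y) = E (v - y)^+, and U'(q) = W(y) with
   W = H + psi (1 - F) / psi'.  Since
     W' = (psi f / psi'^2) (r r'' + r' - 1),
   condition (3) says that W is nonincreasing in y, i.e. that U is convex in q.

   (3) => (1): the posterior mean of the garbled signal is the conditional
   expectation of the posterior mean of the finer one, so Jensen's inequality
   applies.  (1) => (2): every information structure is a garbling of full
   revelation.  (2) => (3): if (3) fails, U is strictly concave on an interval, and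
   pooling that interval at its mean strictly improves on full revelation. *)

(** The formula for W comes from differentiating psi(y) = c/q, which gives y' = - psi / (q psi'),
    and inserting this into U' = H(y) - q (1 - F(y)) y'. The proof itself never differentiates p or
    U in q: [payoff_slope] is just W at the optimal normalized price, and the mean value theorem in
    y yields tangent inequalities, which are all that Jensen and the pooling argument need. The
    other obstacle is measure-theoretic. The price p is arbitrary outside Q and a posterior mean is
    pinned down only almost everywhere, so Buyer's payoff need not be measurable as it stands.
    Functions of the quality are therefore composed with [clamp ql qh]; the iterated integrals do
    not change, because qualities and posterior means lie in Q almost surely. Conditional
    expectations appear only as identities between iterated integrals, checked on events and
    extended to nonnegative functions by reading both sides as integrals against mixtures of
    kernels. *)

Lemma is_derive_fM (R : realType) (f g : R -> R) (x df dg : R) :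
  is_derive x 1 f df -> is_derive x 1 g dg ->
  is_derive x 1 (fun t => f t * g t) (df * g x + f x * dg).
Proof.
move=> Hf Hg; have := is_deriveM Hf Hg; move/is_derive_eq; apply.
by rewrite /GRing.scale/=; ring.
Qed.

Lemma is_derive_fD (R : realType) (f g : R -> R) (x df dg : R) :
  is_derive x 1 f df -> is_derive x 1 g dg ->
  is_derive x 1 (fun t => f t + g t) (df + dg).
Proof. by move=> Hf Hg; exact: (is_deriveD Hf Hg). Qed.

Lemma is_derive_fB (R : realType) (f g : R -> R) (x df dg : R) :
  is_derive x 1 f df -> is_derive x 1 g dg ->
  is_derive x 1 (fun t => f t - g t) (df - dg).
Proof. by move=> Hf Hg; exact: (is_deriveB Hf Hg). Qed.

Lemma is_derive_fdiv (R : realType) (f g : R -> R) (x df dg : R) :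
  is_derive x 1 f df -> is_derive x 1 g dg -> g x != 0 ->
  is_derive x 1 (fun t => f t / g t) ((df * g x - f x * dg) / g x ^+ 2).
Proof.
move=> Hf Hg gx0; have := is_derive_fM Hf (is_deriveV gx0 Hg).
by move/is_derive_eq; apply; rewrite /GRing.scale/=; field.
Qed.

Lemma is_derive_in_continuous (R : realType) (f : R -> R) (x df : R) :
  is_derive x 1 f df -> {for x, continuous f}.
Proof. by move=> H; apply/differentiable_continuous/derivable1_diffP; case: H. Qed.

Lemma derive1_gt0_lt (R : realType) (g dg : R -> R) (x y : R) : x < y ->
  (forall z, x <= z <= y -> is_derive z 1 g (dg z)) ->
  (forall z, x < z < y -> 0 < dg z) -> g x < g y.
Proof.
move=> xy gd g0; have [||z zxy E] := @MVT R g dg x y xy.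
- by move=> z; rewrite in_itv/= => /andP[xz zy]; apply: gd; rewrite !ltW.
- apply: derivable_within_continuous => z; rewrite in_itv/= => zxy.
  by case: (gd z zxy).
by rewrite -subr_gt0 E mulr_gt0 ?subr_gt0// g0.
Qed.

Lemma derive1_le0_ge (R : realType) (g dg : R -> R) (x y : R) : x <= y ->
  (forall z, x <= z <= y -> is_derive z 1 g (dg z)) ->
  (forall z, x < z < y -> dg z <= 0) -> g y <= g x.
Proof.
rewrite le_eqVlt => /predU1P[->//|xy] gd g0.
have [||z zxy E] := @MVT R g dg x y xy.
- by move=> z; rewrite in_itv/= => /andP[xz zy]; apply: gd; rewrite !ltW.
- apply: derivable_within_continuous => z; rewrite in_itv/= => zxy.
  by case: (gd z zxy).
by rewrite -subr_le0 E mulr_le0_ge0 ?subr_ge0 ?(ltW xy)// g0.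
Qed.

(** * The density and its hazard rate *)

Section density.
Context (R : realType) (f : R -> R).
Local Notation leb := (@lebesgue_measure R).
Hypothesis f_gt0 : forall v : R, v \in `]0, 1[ -> 0 < f v.
Hypothesis f_total : (\int[leb]_(x in `[0%R, 1%R]) (f x)%:E)%E = 1%E.
Hypothesis f_der : forall v : R, v \in `]0, 1[ ->
  derivable f v 1 /\ derivable (derive1 f) v 1.

Lemma density_is_derive (v : R) : v \in `]0, 1[ -> is_derive v 1 f (derive1 f v).
Proof. by move=> /f_der[d _]; rewrite derive1E; exact/derivableP. Qed.

Lemma density_is_derive2 (v : R) : v \in `]0, 1[ ->
  is_derive v 1 (derive1 f) (derive1n 2 f v).
Proof. by move=> /f_der[_ d]; rewrite /= derive1E; exact/derivableP. Qed.

Lemma density_measurable : measurable_fun (`[0%R : R, 1%R : R]%classic) f.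
Proof.
apply: (@measurable_fun_itv_cc _ 0 1 false true).
apply: subspace_continuous_measurable_fun => //.
by apply: derivable_within_continuous => x /f_der[].
Qed.

Lemma density_integrable : leb.-integrable `[0%R, 1%R] (EFin \o f).
Proof.
apply/integrableP; split.
  by apply/measurable_EFinP; exact: density_measurable.
have E : (\int[leb]_(x in `[0%R, 1%R]) `|(f x)%:E| = 1)%E.
  rewrite -f_total.
  (* Positivity is known only inside the interval and f(0), f(1) are arbitrary, so the endpoints are
     removed before the absolute value is dropped. *)
  rewrite (@integral_itv_bndoo _ 0 1 _ true false); last first.
    apply/measurableT_comp => //; apply/measurable_EFinP.
    by apply: measurable_funS density_measurable => //; exact: subset_itv_oo_cc.
  rewrite (@integral_itv_bndoo _ 0 1 (EFin \o f) true false); last first.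
    apply/measurable_EFinP.
    by apply: measurable_funS density_measurable => //; exact: subset_itv_oo_cc.
  by apply: eq_integral => x /[!inE]/= /f_gt0 x0; rewrite gtr0_norm.
by rewrite /= E ltry.
Qed.

Lemma moment_integrable : leb.-integrable `[0%R, 1%R] (EFin \o (fun v => v * f v)).
Proof.
apply: le_integrable density_integrable => //.
  apply/measurable_EFinP; apply: measurable_funM => //.
  exact: density_measurable.
move=> x /=; rewrite in_itv/= => /andP[x0 x1].
by rewrite lee_fin normrM ler_piMl// ger0_norm.
Qed.

Local Notation F := (dens_cdf f).

Definition partial_moment (v : R) := (\int[leb]_(x in `[0, v]) (x * f x))%R.
Local Notation K := partial_moment.

Lemma dens_cdfE (v : R) : v <= 1 -> F v = (\int[leb]_(x in `[0, v]) f x)%R.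
Proof.
move=> v1; rewrite /dens_cdf /Rintegral; congr (fine (integral _ _ _)).
apply/seteqP; split => x /=; rewrite !in_itv/=.
  by move=> [/andP[-> _] ->].
by move=> /andP[-> xv]; rewrite xv (le_trans xv).
Qed.

Lemma dens_cdf_ge1 (v : R) : 1 <= v -> F v = 1.
Proof.
move=> v1; rewrite /dens_cdf (_ : _ `&` _ = `[0%R, 1%R]%classic).
  by rewrite f_total.
apply/seteqP; split => x /=; rewrite !in_itv/=; first by case.
by move=> /andP[-> x1]; rewrite x1 (le_trans x1).
Qed.

Lemma dens_cdf_le0 (v : R) : v <= 0 -> F v = 0.
Proof.
move=> v0; rewrite dens_cdfE ?(le_trans v0)//.
have [->|vn0] := eqVneq v 0; first by rewrite set_itv1 Rintegral_set1.
rewrite set_itv_ge ?Rintegral_set0// bnd_simp -ltNge lt_neqAle vn0//.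
Qed.

Lemma dens_cdf_is_derive (v : R) : v \in `]0, 1[ -> is_derive v 1 F (f v).
Proof.
move=> v01; have := v01; rewrite in_itv/= => /andP[v0 v1].
have [] := continuous_FTC1_closed v1 density_integrable v0.
  by case: (density_is_derive v01) => ? _; exact/differentiable_continuous/derivable1_diffP.
move=> dG GE.
apply: (@near_eq_is_derive _ _ _
  (fun y : R => \int[leb]_(x in `[0%R, y]) f x : R)%R).
  near=> y; rewrite dens_cdfE// ltW//.
  have : y \in `]0, 1[ by near: y; exact: near_in_itvoo.
  by rewrite in_itv/= => /andP[].
by rewrite -GE derive1E; exact/derivableP.
Unshelve. all: by end_near. Qed.

Lemma moment_is_derive (v : R) : v \in `]0, 1[ -> is_derive v 1 K (v * f v).
Proof.
move=> v01; have := v01; rewrite in_itv/= => /andP[v0 v1].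
have [] := continuous_FTC1_closed v1 moment_integrable v0.
  apply: is_derive_in_continuous; apply: is_derive_fM; exact: density_is_derive.
by move=> dG GE; rewrite -GE derive1E; exact/derivableP.
Qed.

Lemma dens_cdf_tail (v : R) : 0 <= v <= 1 -> 1 - F v = (\int[leb]_(x in `]v, 1]) f x)%R.
Proof.
move=> /andP[v0 v1]; rewrite -[X in X - _](dens_cdf_ge1 (lexx 1)) !dens_cdfE//.
by rewrite Rintegral_itvB ?bnd_simp//; exact: density_integrable.
Qed.

Lemma dens_cdf_le1 (v : R) : F v <= 1.
Proof.
have [v0|v0] := leP v 0; first by rewrite dens_cdf_le0.
have [v1|v1] := leP 1 v; first by rewrite dens_cdf_ge1.
rewrite -subr_ge0 dens_cdf_tail ?(ltW v0) ?(ltW v1)//.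
rewrite -Rintegral_itv_bndo_bndc.
  apply: Rintegral_ge0 => x /=; rewrite in_itv/= => /andP[vx x1].
  by apply/ltW/f_gt0; rewrite in_itv/= x1 (lt_trans v0).
apply: integrableS density_integrable => // x /=; rewrite !in_itv/= => /andP[vx x1].
by rewrite !ltW// (lt_trans v0).
Qed.

Lemma dens_cdf_lt1 (v : R) : v < 1 -> F v < 1.
Proof.
move=> v1; have [v0|v0] := leP v 0; first by rewrite dens_cdf_le0.
(* F is known to be differentiable only inside (0,1), so strict growth is used up to the midpoint w
   < 1, where F w <= 1. *)
pose w := (v + 1) / 2.
have vw : v < w by rewrite /w; lra.
have w1 : w < 1 by rewrite /w; lra.
apply: lt_le_trans (dens_cdf_le1 w).
apply: (derive1_gt0_lt vw) => x /andP[vx xw].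
  by apply: dens_cdf_is_derive; rewrite in_itv/= (lt_le_trans v0)// (le_lt_trans xw).
by apply: f_gt0; rewrite in_itv/= (lt_trans v0)// (lt_trans xw).
Qed.

(* [E (v - y)^+] for [y] in [`[0, 1]], rewritten so that it can be
   differentiated with the fundamental theorem of calculus. *)
Definition excess (y : R) := K 1 - K y - y * (1 - F y).

Lemma excess_is_derive (y : R) : y \in `]0, 1[ -> is_derive y 1 excess (- (1 - F y)).
Proof.
move=> y01.
have dF := dens_cdf_is_derive y01; have dK := moment_is_derive y01.
have := is_derive_fB (is_derive_fB (is_derive_cst (K 1) y 1) dK)
  (is_derive_fM (is_derive_id y 1) (is_derive_fB (is_derive_cst (1 : R) y 1) dF)).
by move/is_derive_eq; apply => /=; ring.
Qed.

Lemma excessE (y : R) : 0 <= y <= 1 ->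
  (\int[leb]_(v in `[0%R, 1%R]) (Num.max (v - y) 0 * f v)%:E = (excess y)%:E)%E.
Proof.
move=> /andP[y0 y1].
have iB0 : leb.-integrable `[0%R, 1%R] (EFin \o (fun v => v * f v - y * f v)).
  rewrite (_ : _ \o _ = ((EFin \o (fun v : R => v * f v)%R)
                          \- (EFin \o (fun v : R => y * f v)%R))%E)//.
  apply: integrableB => //; first exact: moment_integrable.
  rewrite (_ : _ \o _ = (fun v => y%:E * (f v)%:E)%E)//.
  by apply: integrableZl => //; exact: density_integrable.
have iB : leb.-integrable `]y, 1%R] (EFin \o (fun v => v * f v - y * f v)).
  by apply: integrableS iB0 => //; apply: subset_itvr; rewrite bnd_simp.
have iD : leb.-integrable `]y, 1] (EFin \o f).
  apply: integrableS density_integrable => //.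
  by apply: subset_itvr; rewrite bnd_simp.
have iM : leb.-integrable `]y, 1] (EFin \o (fun v => v * f v)).
  apply: integrableS moment_integrable => //.
  by apply: subset_itvr; rewrite bnd_simp.
transitivity (\int[leb]_(v in `]y, 1%R]) (v * f v - y * f v)%:E)%E.
  rewrite [RHS]integral_mkcond [LHS]integral_mkcond.
  apply: eq_integral => v _; rewrite !patchE !mem_setE !in_itv/=.
  have [yv|vy] := ltP y v.
    have -> : Num.max (v - y) 0 = v - y by rewrite max_l// subr_ge0 ltW.
    by rewrite (le_trans y0 (ltW yv)) mulrBl.
  by rewrite max_r ?subr_le0// mul0r; case: ifP.
rewrite -[LHS]fineK; last by apply: integrable_fin_num.
congr (_%:E); rewrite -/(Rintegral _ _ _) RintegralB//; last first.
  rewrite (_ : _ \o _ = (fun v => y%:E * (f v)%:E)%E)//.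
  by apply: integrableZl.
rewrite RintegralZl// /excess dens_cdf_tail ?y0//; congr (_ - _).
symmetry; apply: Rintegral_itvB; rewrite ?bnd_simp//.
exact: moment_integrable.
Qed.

Lemma excess_integrable (y : R) : 0 <= y <= 1 ->
  leb.-integrable `[0%R, 1%R] (EFin \o (fun v => Num.max (v - y) 0 * f v)).
Proof.
move=> /andP[y0 y1]; apply: le_integrable density_integrable => //.
  apply/measurable_EFinP; apply: measurable_funM; last exact: density_measurable.
  apply: measurable_maxr => //; exact: measurable_funB.
move=> x /=; rewrite in_itv/= => /andP[x0 x1].
rewrite lee_fin normrM ler_piMl// ger0_norm ?le_max ?lexx ?orbT//.
by rewrite ge_max; lra.
Qed.

Local Notation r := (inv_hazard f).
Local Notation psi := (virtual_val f).

(** Closed forms of r' and, below, r'' in terms of f, f', f''. They are easier to differentiate and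
    to show continuous than [derive1], with which they are identified on (0,1). *)
Definition inv_hazard_d1 (v : R) := - 1 - (1 - F v) * derive1 f v / f v ^+ 2.
Local Notation r1 := inv_hazard_d1.

Definition inv_hazard_d2 (v : R) :=
  - (((- f v * derive1 f v + (1 - F v) * derive1n 2 f v) * f v ^+ 2
      - (1 - F v) * derive1 f v * (2 * f v * derive1 f v)) / (f v ^+ 2) ^+ 2).
Local Notation r2 := inv_hazard_d2.

Lemma inv_hazard_is_derive (v : R) : v \in `]0, 1[ -> is_derive v 1 r (r1 v).
Proof.
move=> v01; have fv0 : f v != 0 by rewrite gt_eqF// f_gt0.
have dF := dens_cdf_is_derive v01; have df := density_is_derive v01.
have := is_derive_fdiv (is_derive_fB (is_derive_cst (1 : R) v 1) dF) df fv0.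
by move/is_derive_eq; apply; rewrite /r1 /=; field.
Qed.

Lemma derive1_inv_hazard (v : R) : v \in `]0, 1[ -> derive1 r v = r1 v.
Proof. by move=> /inv_hazard_is_derive[_]; rewrite derive1E. Qed.

Lemma inv_hazard_d1_is_derive (v : R) : v \in `]0, 1[ ->
  is_derive v 1 r1 (r2 v).
Proof.
move=> v01; have fv0 : f v != 0 by rewrite gt_eqF// f_gt0.
have dF := dens_cdf_is_derive v01; have df := density_is_derive v01.
have df2 := density_is_derive2 v01.
have dff : is_derive v 1 (fun t => f t ^+ 2) (2 * f v * derive1 f v).
  have := is_derive_fM df df; move/is_derive_eq; apply; ring.
have fv20 : f v ^+ 2 != 0 by rewrite expf_neq0.
have := is_derive_fB (is_derive_cst (- 1 : R) v 1)
  (is_derive_fdiv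
    (is_derive_fM (is_derive_fB (is_derive_cst (1 : R) v 1) dF) df2) dff fv20).
by move/is_derive_eq; apply; rewrite /r2 /=; field.
Qed.

Lemma derive2_inv_hazard (v : R) : v \in `]0, 1[ -> derive1n 2 r v = r2 v.
Proof.
move=> v01; have [_] := inv_hazard_d1_is_derive v01.
(* A derivative depends only on values near v, and there [derive1 r] equals its closed form. *)
move=> <-; rewrite /= derive1E; apply: near_eq_derive; near=> y.
rewrite derive1_inv_hazard//; near: y; exact: near_in_itvoo.
Unshelve. all: by end_near. Qed.

Lemma virtual_val_is_derive (v : R) : v \in `]0, 1[ ->
  is_derive v 1 psi (1 - r1 v).
Proof.
move=> v01.
exact: is_derive_fB (is_derive_id v 1) (inv_hazard_is_derive v01).
Qed.

Lemma derive1_virtual_val (v : R) : v \in `]0, 1[ -> derive1 psi v = 1 - r1 v.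
Proof. by move=> /virtual_val_is_derive[_]; rewrite derive1E. Qed.

(* The derivative of Buyer's payoff in the quality, as a function of the
   normalized price [y]. *)
Definition marginal_payoff (y : R) :=
  excess y + psi y * (1 - F y) / (1 - r1 y).
Local Notation W := marginal_payoff.

(** With psi' = 1 - r' and psi'' = - r'', the terms 1 - F cancel and - psi f / psi' + psi (1 - F)
    r'' / psi'^2 remains. Substituting 1 - F = r f factors out psi f / psi'^2. *)
Lemma marginal_payoff_is_derive (y : R) : y \in `]0, 1[ -> 0 < 1 - r1 y ->
  is_derive y 1 W
    (psi y * f y / (1 - r1 y) ^+ 2 * (r y * r2 y + r1 y - 1)).
Proof.
move=> y01 d0; have fy0 : f y != 0 by rewrite gt_eqF// f_gt0.
have dn0 : 1 - r1 y != 0 by rewrite gt_eqF.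
have dF := dens_cdf_is_derive y01; have dH := excess_is_derive y01.
have dpsi := virtual_val_is_derive y01; have dr1 := inv_hazard_d1_is_derive y01.
have := is_derive_fD dH (is_derive_fdiv
  (is_derive_fM dpsi (is_derive_fB (is_derive_cst (1 : R) y 1) dF))
  (is_derive_fB (is_derive_cst (1 : R) y 1) dr1) dn0).
move/is_derive_eq; apply; rewrite /=.
have -> : r y = (1 - F y) / f y by [].
move: (psi y) (r1 y) (r2 y) (F y) (f y) dn0 fy0 => A B C D E dn0 fy0.
by field; rewrite fy0 dn0.
Qed.

Hypothesis psi_reg : forall v : R, v \in `]0, 1[ -> 0 < psi v -> 0 < derive1 psi v.

Lemma virtual_val_d_gt0 (v : R) : v \in `]0, 1[ -> 0 < psi v -> 0 < 1 - r1 v.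
Proof. by move=> v01 /(psi_reg v01); rewrite derive1_virtual_val. Qed.

(** [psi_reg] speaks only of points where psi is positive, so positivity along the whole interval is
    assumed here; [virtual_val_incr] then reduces it to the left endpoint. *)
Lemma virtual_val_incr_pos (x y : R) : 0 < x -> x < y -> y < 1 ->
  (forall z, x <= z <= y -> 0 < psi z) -> psi x < psi y.
Proof.
move=> x0 xy y1 pos.
have in01 z : x <= z <= y -> z \in `]0, 1[.
  by move=> /andP[xz zy]; rewrite in_itv/= (lt_le_trans x0)// (le_lt_trans zy).
apply: (@derive1_gt0_lt _ psi (fun z => 1 - r1 z) _ _ xy) => z.
  by move=> zxy; apply: virtual_val_is_derive; exact: in01.
move=> /andP[xz zy].
by apply: virtual_val_d_gt0; [apply: in01|apply: pos]; rewrite !ltW.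
Qed.

(* At a maximizer [z < y] of [psi] on [[x, y]], [psi] would be positive and
   increasing on a right neighbourhood; so the maximum is attained at [y]. *)
Lemma virtual_val_incr (x y : R) : 0 < x -> x < y -> y < 1 -> 0 < psi x ->
  psi x < psi y.
Proof.
move=> x0 xy y1 px0.
(* The weak inequality already makes psi positive on all of [x, y], and then [virtual_val_incr_pos]
   gives the strict one. *)
suff mono y' : x < y' -> y' < 1 -> psi x <= psi y'.
  apply: virtual_val_incr_pos => // z /andP[xz zy].
  apply: lt_le_trans px0 _.
  move: xz; rewrite le_eqVlt => /predU1P[<-//|xz].
  by apply: mono => //; exact: le_lt_trans y1.
move=> {xy y1}{}xy y1; move: y' xy y1 => {}y xy y1.
have in01 z : x <= z <= y -> z \in `]0, 1[.
  by move=> /andP[xz zy]; rewrite in_itv/= (lt_le_trans x0)// (le_lt_trans zy).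
have [|z] := @EVT_max R psi x y (ltW xy).
  apply: derivable_within_continuous => z; rewrite in_itv/= => zxy.
  by case: (@virtual_val_is_derive z) => //; rewrite in01.
rewrite in_itv/= => /andP[xz zy] zmax.
have pz0 : 0 < psi z by rewrite (lt_le_trans px0)// zmax// in_itv/= lexx ltW.
move: zy; rewrite le_eqVlt => /predU1P[zy|zy].
  by rewrite -zy; apply: zmax; rewrite in_itv/= lexx ltW.
have z01 : z \in `]0, 1[ by rewrite in01// xz ltW.
have cz := is_derive_in_continuous (virtual_val_is_derive z01).
have : \forall t \near z, 0 < psi t by move: cz => /cvgr_gt; apply.
move=> /nbhs_ballP[e /= e0 be].
pose t := Num.min ((z + y) / 2) (z + e / 2).
have zt : z < t by rewrite /t lt_min; apply/andP; split; lra.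
have ty : t < y by rewrite /t gt_min; apply/orP; left; lra.
have te : t <= z + e / 2 by rewrite /t ge_min lexx orbT.
have : psi z < psi t.
  apply: virtual_val_incr_pos => //; first exact: lt_le_trans xz.
    exact: lt_trans y1.
  move=> s /andP[zs st]; apply: be; rewrite /ball/= ltr_norml; apply/andP; split; lra.
rewrite ltNge zmax// in_itv/= (ltW ty) andbT; exact: le_trans (ltW zt).
Qed.

Lemma virtual_val_incr_le (x y : R) : 0 < x -> x <= y -> y < 1 -> 0 < psi x ->
  psi x <= psi y.
Proof.
move=> x0; rewrite le_eqVlt => /predU1P[->//|xy] y1 px.
exact/ltW/virtual_val_incr.
Qed.

(* [c / psi z] is the quality at which Seller's optimal normalized price is [z],
   so this is the mean value theorem for Buyer's payoff minus a linear function,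
   parametrized by the price rather than by the quality. *)
Lemma payoff_mean_value (c a b y z : R) : 0 < c -> 0 < a -> b < 1 -> 0 < psi a ->
  a <= y <= b -> a <= z <= b -> y != z ->
  exists2 x, Num.min y z < x < Num.max y z &
  exists2 k, 0 < k &
  (excess z - W y) * (c / psi z) - (excess y - W y) * (c / psi y) =
  k * (W y - W x) * (z - y).
Proof.
move=> c0 a0 b1 pa yab zab yz.
pose g t := (excess t - W y) * (c / psi t).
(* k is minus the derivative of the quality c / psi t in the price t. The payoff
   [excess t * (c / psi t)] thus has derivative - k W, and g has derivative k (W y - W t). *)
pose k t := c * (1 - r1 t) / psi t ^+ 2.
have in01 t : a <= t <= b -> t \in `]0, 1[.
  by move=> /andP[at_ tb]; rewrite in_itv/= (lt_le_trans a0)// (le_lt_trans tb).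
have pos t : a <= t <= b -> 0 < psi t.
  move=> /andP[at_ tb]; rewrite (lt_le_trans pa)//.
  by apply: virtual_val_incr_le => //; exact: le_lt_trans b1.
have kpos t : a <= t <= b -> 0 < k t.
  move=> tab; rewrite /k divr_gt0// ?exprn_gt0 ?pos// mulr_gt0//.
  by apply: virtual_val_d_gt0; [exact: in01|exact: pos].
have dg t : a <= t <= b -> is_derive t 1 g (k t * (W y - W t)).
  move=> tab; have pt := pos _ tab; have t01 := in01 _ tab.
  have d0 := virtual_val_d_gt0 t01 pt.
  have pn0 : psi t != 0 by rewrite gt_eqF.
  have := is_derive_fM (is_derive_fB (excess_is_derive t01)
      (is_derive_cst (W y) t 1))
    (is_derive_fdiv (is_derive_cst c t 1) (virtual_val_is_derive t01) pn0).
  move/is_derive_eq; apply; rewrite /k [W t]/W /=.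
  have dn0 : 1 - r1 t != 0 by rewrite gt_eqF.
  move: (psi t) (r1 t) (F t) (excess t) (W y) pn0 dn0 => A B C D E pn0 dn0.
  by field; rewrite dn0.
have [u [v [uv uab vab]]] : exists u v, [/\ u < v, a <= u & v <= b /\
    (u = y /\ v = z \/ u = z /\ v = y)].
  move: yab zab => /andP[ay yb] /andP[az zb].
  have [h|h|h] := ltgtP y z; last by rewrite h eqxx in yz.
    by exists y, z; split => //; split => //; left.
  by exists z, y; split => //; split => //; right.
case: vab => vb uvE.
have sub t : u <= t <= v -> a <= t <= b.
  by move=> /andP[ut tv]; rewrite (le_trans uab)// (le_trans tv).
have [||x] := @MVT R g (fun t => k t * (W y - W t)) u v uv.
- move=> t; rewrite in_itv/= => /andP[ut tv]; apply: dg; apply: sub.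
  by rewrite !ltW.
- apply: derivable_within_continuous => t; rewrite in_itv/= => tuv.
  by case: (@dg t) => //; exact: sub.
rewrite in_itv/= => /andP[ux xv] E.
exists x; first by case: uvE => -[? ?]; subst u v;
  [rewrite min_l ?max_r ?ltW// | rewrite min_r ?max_l ?ltW//]; rewrite ux.
exists (k x); first by apply/kpos/sub; rewrite !ltW.
rewrite -/(g z) -/(g y); case: uvE => -[? ?]; subst u v; first exact: E.
by rewrite -[LHS]opprB E; ring.
Qed.

Hypothesis f_cont2 : {in `]0, 1[, continuous (derive1n 2 f)}.

(** Spreads a strict violation of (3) from one price to an interval. The continuity of f'' enters
    here, through r''. *)
Lemma convexity_cond_continuous (v : R) : v \in `]0, 1[ ->
  {for v, continuous (fun t => r t * r2 t + r1 t)}.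
Proof.
move=> v01; have fv0 : f v != 0 by rewrite gt_eqF// f_gt0.
have cF := is_derive_in_continuous (dens_cdf_is_derive v01).
have cf := is_derive_in_continuous (density_is_derive v01).
have cf1 := is_derive_in_continuous (density_is_derive2 v01).
have cf2 := f_cont2 v01.
have cr := is_derive_in_continuous (inv_hazard_is_derive v01).
have cr1 := is_derive_in_continuous (inv_hazard_d1_is_derive v01).
apply: cvgD => //; apply: cvgM => //; rewrite /r2; apply: cvgN.
have cff : f t ^+ 2 @[t --> v] --> f v ^+ 2 by apply: cvgM.
apply: cvgM; last first.
  by apply: cvgV; [rewrite !expf_neq0|apply: cvgM].
apply: cvgB.
  apply: cvgM => //; apply: cvgD.
    by apply: cvgM => //; apply: cvgN.
  by apply: cvgM => //; apply: cvgB => //; exact: cvg_cst.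
apply: cvgM.
  by apply: cvgM => //; apply: cvgB => //; exact: cvg_cst.
by apply: cvgM => //; apply: cvgM => //; exact: cvg_cst.
Qed.

End density.

(** * Buyer's payoff as a function of the quality *)

Section payoff.
Context (R : realType) (ql qh c : R) (f p : R -> R).
Local Notation leb := (@lebesgue_measure R).
Hypothesis c_gt0 : 0 < c.
Hypothesis c_lt_ql : c < ql.
Hypothesis ql_lt_qh : ql < qh.
Hypothesis f_gt0 : forall v : R, v \in `]0, 1[ -> 0 < f v.
Hypothesis f_total : (\int[leb]_(x in `[0%R, 1%R]) (f x)%:E)%E = 1%E.
Hypothesis f_der : forall v : R, v \in `]0, 1[ ->
  derivable f v 1 /\ derivable (derive1 f) v 1.
Hypothesis f_cont2 : {in `]0, 1[, continuous (derive1n 2 f)}.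
Hypothesis psi_reg : forall v : R, v \in `]0, 1[ ->
  0 < virtual_val f v -> 0 < derive1 (virtual_val f) v.
Hypothesis p_opt : forall q : R, q \in `[ql, qh] -> forall p' : R, p' != p q ->
  (p' - c) * (1 - dens_cdf f (p' / q)) < (p q - c) * (1 - dens_cdf f (p q / q)).

Local Notation F := (dens_cdf f).
Local Notation psi := (virtual_val f).
Local Notation r := (inv_hazard f).
Local Notation r1 := (inv_hazard_d1 f).
Local Notation r2 := (inv_hazard_d2 f).
Local Notation W := (marginal_payoff f).
Let pbar (q : R) := p q / q.
Definition payoff_at (q : R) := q * excess f (p q / q).
(** Plays the part of U'(q), but only as the slope of a supporting line. *)
Definition payoff_slope (q : R) := W (p q / q).
Local Notation U := payoff_at.
Local Notation D := payoff_slope.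

Lemma quality_gt q : q \in `[ql, qh] -> c < q.
Proof. by rewrite in_itv/= => /andP[+ _]; exact: lt_le_trans. Qed.

(** The optimal profit is positive, which excludes prices at or below c (no margin) and at or above
    q (no sale). *)
Lemma norm_price_in01 q : q \in `[ql, qh] -> pbar q \in `]0, 1[.
Proof.
move=> qQ; have cq := quality_gt qQ; have q0 := lt_trans c_gt0 cq.
have val0 : 0 < (p q - c) * (1 - F (p q / q)).
  (* A price strictly between c and q has a positive margin and a positive probability of sale. *)
  pose p' := (c + q) / 2.
  have val' : 0 < (p' - c) * (1 - F (p' / q)).
    rewrite mulr_gt0//; first by rewrite /p'; lra.
    rewrite subr_gt0; apply: dens_cdf_lt1 => //.
    by rewrite ltr_pdivrMr// mul1r /p'; lra.
  have [<-//|np] := eqVneq p' (p q).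
  exact: lt_trans val' (p_opt qQ np).
have F1 : F (pbar q) <= 1 by exact: dens_cdf_le1.
have pc : c < p q.
  rewrite ltNge; apply/negP => pc.
  by move: val0; rewrite ltNge => /negP; apply; rewrite mulr_le0_ge0 ?subr_le0 ?subr_ge0.
rewrite in_itv/= divr_gt0 ?(lt_trans c_gt0)//= ltNge; apply/negP => y1.
by move: val0; rewrite (@dens_cdf_ge1 _ _ _ (p q / q))// subrr mulr0 ltxx.
Qed.

(** The profit as a function of y = p/q has an interior maximum, so q (1 - F y) = (q y - c) f y;
    dividing by q f y gives r y = y - c/q. *)
Lemma virtual_val_norm_price q : q \in `[ql, qh] -> psi (pbar q) = c / q.
Proof.
move=> qQ; have cq := quality_gt qQ; have q0 := lt_trans c_gt0 cq.
have y01 := norm_price_in01 qQ.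
pose g (y : R) := (q * y - c) * (1 - F y).
have dg (y : R) : y \in `]0, 1[ -> is_derive y 1 g (q * (1 - F y) - (q * y - c) * f y).
  move=> yI; have dF := dens_cdf_is_derive f_gt0 f_total f_der yI.
  have := is_derive_fM (is_derive_fB (is_derive_fM (is_derive_cst q y 1)
    (is_derive_id y 1)) (is_derive_cst c y 1))
    (is_derive_fB (is_derive_cst (1 : R) y 1) dF).
  by move/is_derive_eq; apply; rewrite /=; ring.
have [|||_ d0] := @derive1_at_max R g 0 1 (pbar q) ler01.
- by move=> y /dg[].
- by [].
- move=> y _; rewrite /g.
  have -> : q * pbar q = p q by rewrite /pbar mulrC divfK// gt_eqF.
  have [->|ny] := eqVneq y (pbar q).
    by have -> : q * pbar q = p q by rewrite /pbar mulrC divfK// gt_eqF.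
  have np : q * y != p q.
    apply: contra ny => /eqP h; rewrite /pbar -h (mulrC q) mulfK//.
    by rewrite gt_eqF.
  have /ltW := p_opt qQ np.
  by have -> : q * y / q = y by field; rewrite gt_eqF.
have [_] := dg _ y01; rewrite d0 => /esym/eqP; rewrite subr_eq0 => /eqP FOC.
have fy := f_gt0 y01.
rewrite /virtual_val /inv_hazard.
have -> : 1 - F (pbar q) = (q * pbar q - c) * f (pbar q) / q.
  by rewrite -FOC; field; rewrite gt_eqF.
by field; rewrite !gt_eqF.
Qed.

Lemma virtual_val_norm_price_gt0 q : q \in `[ql, qh] -> 0 < psi (pbar q).
Proof.
move=> qQ; rewrite virtual_val_norm_price// divr_gt0//.
exact: lt_trans c_gt0 (quality_gt qQ).
Qed.

Lemma norm_price_gt_psi q (y : R) : q \in `[ql, qh] -> y \in `]0, 1[ ->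
  c / q < psi y -> pbar q < y.
Proof.
move=> qQ; rewrite in_itv/= => /andP[y0 y1]; rewrite -virtual_val_norm_price//.
have := norm_price_in01 qQ; rewrite in_itv/= => /andP[z0 z1].
move=> py; have p0 := virtual_val_norm_price_gt0 qQ; move: py.
rewrite ltNge; apply: contraNT; rewrite -leNgt => h.
(* psi is monotone only from a point where it is positive; where psi y <= 0 the bound is
   immediate. *)
have [py|py] := leP (psi y) 0; first by rewrite (le_trans py)// ltW.
exact: virtual_val_incr_le.
Qed.

Lemma norm_price_anti q q' : q \in `[ql, qh] -> q' \in `[ql, qh] -> q <= q' ->
  pbar q' <= pbar q.
Proof.
move=> qQ qQ'; rewrite le_eqVlt => /predU1P[->//|qq'].
have q0 : 0 < q by exact: lt_trans c_gt0 (quality_gt qQ).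
apply/ltW/norm_price_gt_psi => //; first exact: norm_price_in01.
rewrite virtual_val_norm_price// ltr_pM2l// ltf_pV2// posrE//.
exact: lt_trans qq'.
Qed.

Lemma buyer_utilE q : q \in `[ql, qh] -> buyer_util f p q = (U q)%:E.
Proof.
move=> qQ; have q0 : 0 < q by exact: lt_trans c_gt0 (quality_gt qQ).
have := norm_price_in01 qQ; rewrite in_itv/= => /andP[y0 y1].
have y01 : 0 <= pbar q <= 1 by rewrite !ltW.
rewrite /buyer_util /U EFinM -excessE// -integralZl//; last first.
  exact: excess_integrable.
apply: eq_integral => v _; rewrite -EFinM mulrA; congr ((_ * _)%:E).
rewrite maxr_pMr ?(ltW q0)// mulr0; congr Num.max.
by rewrite /pbar; field; rewrite gt_eqF.
Qed.

Lemma buyer_util_ge0 q : (0 <= buyer_util f p q)%E.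
Proof.
rewrite /buyer_util (@integral_itv_bndoo _ 0 1 _ true false).
  apply: integral_ge0 => v /= v01; rewrite lee_fin mulr_ge0 ?le_max ?lexx ?orbT//.
  exact/ltW/f_gt0.
apply/measurable_EFinP/measurable_funM.
  by apply: measurable_maxr => //; apply: measurable_funB => //; exact: measurable_funM.
apply: measurable_funS (density_measurable f_der) => //; exact: subset_itv_oo_cc.
Qed.

Lemma payoff_at_ge0 q : q \in `[ql, qh] -> 0 <= U q.
Proof. by move=> qQ; rewrite -lee_fin -buyer_utilE// buyer_util_ge0. Qed.

(** [payoff_mean_value] read in qualities through q = c / psi (pbar q). Since x lies between the two
    prices, monotonicity of W alone fixes the sign of the right-hand side: nonnegative if W is
    nonincreasing, negative if W is increasing. *)
Lemma payoff_at_mean_value s t : s \in `[ql, qh] -> t \in `[ql, qh] -> s != t ->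
  exists2 x, Num.min (pbar t) (pbar s) < x < Num.max (pbar t) (pbar s) &
  exists2 k, 0 < k &
  U s - (U t + D t * (s - t)) = k * (D t - W x) * (pbar s - pbar t).
Proof.
move=> sQ tQ st.
have q0 q : q \in `[ql, qh] -> 0 < q by move=> ?; exact: lt_trans c_gt0 (quality_gt _).
have inv q : q \in `[ql, qh] -> c / psi (pbar q) = q.
  move=> qQ; rewrite virtual_val_norm_price//; field.
  by rewrite !gt_eqF// q0.
have pst : pbar t != pbar s.
  by apply: contra st => /eqP E; rewrite -(inv s)// -E inv.
have lQ : ql \in `[ql, qh] by rewrite in_itv/= lexx ltW.
have hQ : qh \in `[ql, qh] by rewrite in_itv/= lexx ltW.
have rng q : q \in `[ql, qh] -> pbar qh <= pbar q <= pbar ql.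
  move=> qQ; have := qQ; rewrite in_itv/= => /andP[lq qh'].
  by rewrite !norm_price_anti.
have := norm_price_in01 hQ; rewrite in_itv/= => /andP[h0 h1].
have := norm_price_in01 lQ; rewrite in_itv/= => /andP[l0 l1].
have [x xE [k k0 E]] := payoff_mean_value f_gt0 f_total f_der psi_reg c_gt0 h0 l1
  (virtual_val_norm_price_gt0 hQ) (rng t tQ) (rng s sQ) pst.
exists x => //; exists k => //; rewrite -E !inv// /U /D /pbar; ring.
Qed.

Lemma payoff_convex :
  (forall v, pbar qh < v < pbar ql -> r v * derive1n 2 r v + derive1 r v <= 1) ->
  forall s t, s \in `[ql, qh] -> t \in `[ql, qh] -> U t + D t * (s - t) <= U s.
Proof.
move=> cond.
have lQ : ql \in `[ql, qh] by rewrite in_itv/= lexx ltW.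
have hQ : qh \in `[ql, qh] by rewrite in_itv/= lexx ltW.
have := norm_price_in01 hQ; rewrite in_itv/= => /andP[h0 h1].
have := norm_price_in01 lQ; rewrite in_itv/= => /andP[l0 l1].
have in01 y : pbar qh <= y <= pbar ql -> y \in `]0, 1[.
  by move=> /andP[hy yl]; rewrite in_itv/= (lt_le_trans h0)// (le_lt_trans yl).
have pos y : pbar qh <= y <= pbar ql -> 0 < psi y.
  move=> /andP[hy yl]; apply: lt_le_trans (virtual_val_norm_price_gt0 hQ) _.
  by apply: virtual_val_incr_le => //; [exact: le_lt_trans l1|exact: virtual_val_norm_price_gt0].
(* (3) is the sign of the last factor of W'. It is given on the open price range only, which
   suffices because [derive1_le0_ge] asks for the sign of the derivative in the interior. *)
have Wni y z : pbar qh <= y -> y <= z -> z <= pbar ql -> W z <= W y.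
  move=> hy yz zl; apply: (derive1_le0_ge yz) => x /andP[yx xz].
    have xI : pbar qh <= x <= pbar ql by rewrite (le_trans hy)// (le_trans xz).
    apply: marginal_payoff_is_derive => //; first exact: in01.
    by apply: virtual_val_d_gt0 => //; [exact: in01|exact: pos].
  have xI : pbar qh < x < pbar ql by rewrite (le_lt_trans hy)// (lt_le_trans xz).
  have xI' : pbar qh <= x <= pbar ql by case/andP: xI => *; rewrite !ltW.
  rewrite mulr_ge0_le0//.
    rewrite divr_ge0 ?sqr_ge0// mulr_ge0 ?(ltW (pos _ xI'))//.
    exact/ltW/f_gt0/in01.
  have := cond _ xI; rewrite derive2_inv_hazard ?derive1_inv_hazard ?subr_le0//; exact: in01.
move=> s t sQ tQ; have [->|st] := eqVneq s t; first by rewrite subrr mulr0 addr0.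
have [x xE [k k0 E]] := payoff_at_mean_value sQ tQ st.
rewrite -subr_ge0 E -mulrA mulr_ge0 ?(ltW k0)//.
have rng q : q \in `[ql, qh] -> pbar qh <= pbar q /\ pbar q <= pbar ql.
  move=> qQ; have := qQ; rewrite in_itv/= => /andP[lq qh'].
  by rewrite !norm_price_anti.
have [hs sl] := rng _ sQ; have [ht tl] := rng _ tQ.
have [pst|pst|pst] := ltgtP (pbar t) (pbar s).
- move: xE; rewrite min_l ?max_r ?(ltW pst)// => /andP[tx xs].
  rewrite mulr_ge0 ?subr_ge0 ?(ltW pst)//; apply: Wni => //; first exact: ltW.
  exact: le_trans (ltW xs) _.
- move: xE; rewrite min_r ?max_l ?(ltW pst)// => /andP[sx xt].
  rewrite mulr_le0 ?subr_le0 ?(ltW pst)//; apply: Wni => //; last exact: ltW.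
  exact: le_trans hs (ltW sx).
- by rewrite pst subrr mulr0.
Qed.

(** Add the tangent inequalities for (s, t) and (t, s). Monotonicity is what makes D measurable and
    bounded on Q when Jensen's inequality is applied. *)
Lemma payoff_slope_nondecreasing :
  (forall s t, s \in `[ql, qh] -> t \in `[ql, qh] -> U t + D t * (s - t) <= U s) ->
  {in `[ql, qh] &, {homo D : x y / x <= y}}.
Proof.
move=> cvx s t sQ tQ; rewrite le_eqVlt => /predU1P[->//|st].
have := cvx s t sQ tQ; have := cvx t s tQ sQ => h1 h2.
have : (D t - D s) * (t - s) >= 0 by lra.
by rewrite pmulr_lge0 ?subr_gt0// subr_ge0.
Qed.

(** Both H and the normalized price are nonincreasing. This gives measurability and an upper bound
    for U without any regularity of p. *)
Lemma excess_norm_price_nondecreasing :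
  {in `[ql, qh] &, {homo (fun q => excess f (p q / q)) : x y / x <= y}}.
Proof.
move=> s t sQ tQ st; apply: (derive1_le0_ge (norm_price_anti sQ tQ st)) => x /andP[tx xs].
  apply: excess_is_derive => //.
  have := norm_price_in01 sQ; have := norm_price_in01 tQ; rewrite !in_itv/=.
  by move=> /andP[t0 _] /andP[_ s1]; rewrite (lt_le_trans t0)// (le_lt_trans xs).
by rewrite oppr_le0 subr_ge0 dens_cdf_le1.
Qed.

Lemma payoff_strictly_concave v : pbar qh < v < pbar ql ->
  1 < r v * derive1n 2 r v + derive1 r v ->
  exists q1 q2, [/\ ql <= q1, q1 < q2, q2 <= qh &
    forall s t, s \in `[q1, q2] -> t \in `[q1, q2] -> s != t ->
      U s < U t + D t * (s - t)].
Proof.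
move=> /andP[hv vl] cond.
have lQ : ql \in `[ql, qh] by rewrite in_itv/= lexx ltW.
have hQ : qh \in `[ql, qh] by rewrite in_itv/= lexx ltW.
have := norm_price_in01 hQ; rewrite in_itv/= => /andP[h0 h1].
have := norm_price_in01 lQ; rewrite in_itv/= => /andP[l0 l1].
have in01 y : pbar qh <= y <= pbar ql -> y \in `]0, 1[.
  by move=> /andP[hy yl]; rewrite in_itv/= (lt_le_trans h0)// (le_lt_trans yl).
have v01 : v \in `]0, 1[ by rewrite in01// !ltW.
have pos y : pbar qh <= y <= pbar ql -> 0 < psi y.
  move=> /andP[hy yl]; apply: lt_le_trans (virtual_val_norm_price_gt0 hQ) _.
  by apply: virtual_val_incr_le => //; [exact: le_lt_trans l1|exact: virtual_val_norm_price_gt0].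
move: cond; rewrite derive2_inv_hazard// derive1_inv_hazard// => cond.
have /cvgr_gt/(_ 1 cond) := convexity_cond_continuous f_gt0 f_total f_der f_cont2 v01.
move=> /nbhs_ballP[e /= e0 be].
(* [a, b] surrounds v and stays both strictly inside the price range and inside the ball where (3)
   fails. *)
pose a := Num.max ((pbar qh + v) / 2) (v - e / 2).
pose b := Num.min ((pbar ql + v) / 2) (v + e / 2).
have ha : pbar qh < a by rewrite /a lt_max; apply/orP; left; lra.
have bl : b < pbar ql by rewrite /b gt_min; apply/orP; left; lra.
have av : a < v by rewrite /a gt_max; apply/andP; split; lra.
have vb : v < b by rewrite /b lt_min; apply/andP; split; lra.
have ae : v - e / 2 <= a by rewrite /a le_max lexx orbT.
have eb : b <= v + e / 2 by rewrite /b ge_min lexx orbT.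
have sub y : a <= y <= b -> pbar qh <= y <= pbar ql.
  by move=> /andP[ay yb]; rewrite (le_trans (ltW ha))// (le_trans yb (ltW bl)).
have Winc y z : a <= y -> y < z -> z <= b -> W y < W z.
  move=> ay yz zb; apply: (derive1_gt0_lt yz) => x /andP[yx xz].
    have xI : pbar qh <= x <= pbar ql by apply: sub; rewrite (le_trans ay)// (le_trans xz).
    apply: marginal_payoff_is_derive => //; first exact: in01.
    by apply: virtual_val_d_gt0 => //; [exact: in01|exact: pos].
  have ax : a <= x by rewrite (le_trans ay)// ltW.
  have xb : x <= b by rewrite (le_trans (ltW xz)).
  have xI : pbar qh <= x <= pbar ql by apply: sub; rewrite ax.
  rewrite mulr_gt0//.
    rewrite divr_gt0 ?exprn_gt0//; last by apply: virtual_val_d_gt0 => //; [exact: in01|exact: pos].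
    by rewrite mulr_gt0 ?pos// f_gt0// in01.
  rewrite subr_gt0; apply: be; rewrite /ball/= ltr_norml; apply/andP; split; lra.
have ab : a < b by exact: lt_trans vb.
have aI : pbar qh <= a <= pbar ql by apply: sub; rewrite lexx ltW.
have bI : pbar qh <= b <= pbar ql by apply: sub; rewrite lexx ltW.
have pa := pos _ aI; have pb := pos _ bI.
have a0 : 0 < a by exact: lt_trans ha.
have b1 : b < 1 by exact: lt_trans l1.
have ql0 : 0 < ql by exact: lt_trans c_lt_ql.
have qh0 : 0 < qh by exact: lt_trans ql_lt_qh.
have pbl : psi b <= c / ql.
  by rewrite -virtual_val_norm_price// virtual_val_incr_le// ?ltW// (lt_trans a0).
have pah : c / qh <= psi a.
  by rewrite -virtual_val_norm_price// virtual_val_incr_le// ?ltW ?virtual_val_norm_price_gt0//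
     ?(lt_trans av)// (lt_trans vb).
have lq1 : ql <= c / psi b by rewrite ler_pdivlMr// mulrC -ler_pdivlMr.
have q2h : c / psi a <= qh by rewrite ler_pdivrMr// mulrC -ler_pdivrMr.
(* Passing from prices to qualities reverses the order, so the upper price b gives the lower
   quality. *)
exists (c / psi b), (c / psi a); split => //.
  rewrite ltr_pM2l// ltf_pV2// ?posrE//.
  exact: virtual_val_incr.
have subQ q : q \in `[c / psi b, c / psi a] -> q \in `[ql, qh].
  by rewrite !in_itv/= => /andP[h3 h4]; rewrite (le_trans lq1)// (le_trans h4).
have rng q : q \in `[c / psi b, c / psi a] -> a <= pbar q /\ pbar q <= b.
  move=> qI; have qQ := subQ _ qI; have q0 : 0 < q by exact: lt_trans c_gt0 (quality_gt qQ).
  move: qI; rewrite in_itv/= => /andP[h3 h4]; split; rewrite leNgt; apply/negP => h.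
    have : psi (pbar q) < psi a.
      apply: virtual_val_incr => //; [|exact: lt_trans b1|exact: virtual_val_norm_price_gt0].
      by have := norm_price_in01 qQ; rewrite in_itv/= => /andP[].
    by rewrite virtual_val_norm_price// ltr_pdivrMr// mulrC -ltr_pdivrMr// ltNge h4.
  have : psi b < psi (pbar q).
    apply: virtual_val_incr => //; first exact: lt_trans ab.
    by have := norm_price_in01 qQ; rewrite in_itv/= => /andP[].
  by rewrite virtual_val_norm_price// ltr_pdivlMr// mulrC -ltr_pdivlMr// ltNge h3.
move=> s t sI tI st.
have [x xE [k k0 E]] := payoff_at_mean_value (subQ _ sI) (subQ _ tI) st.
rewrite -subr_lt0 E -mulrA pmulr_rlt0//.
have [hs sl] := rng _ sI; have [ht tl] := rng _ tI.
have [pst|pst|pst] := ltgtP (pbar t) (pbar s).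
- move: xE; rewrite min_l ?max_r ?(ltW pst)// => /andP[tx xs].
  rewrite nmulr_rlt0 ?subr_gt0// subr_lt0; apply: Winc => //.
  exact: le_trans (ltW xs) _.
- move: xE; rewrite min_r ?max_l ?(ltW pst)// => /andP[sx xt].
  rewrite pmulr_rlt0 ?subr_lt0// subr_gt0; apply: Winc => //.
  exact: le_trans hs (ltW sx).
- by move/andP: xE => -[h3 h4]; have := lt_trans h3 h4; rewrite pst minxx maxxx ltxx.
Qed.

End payoff.

(** * Integration off null sets and mixtures of kernels *)

Section off_null.
Local Open Scope ereal_scope.
Context d (T : measurableType d) (R : realType).
Variable mu : {measure set T -> \bar R}.
Implicit Types (N : set T) (f g : T -> \bar R).
Import HBNNSimple.

(* No measurability is assumed: simple functions below [f] can be cut off on [N].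
   This matters because [p], hence [buyer_util f p], is arbitrary outside [Q]. *)
Lemma ge0_le_integral_off_null N f g : measurable N -> mu N = 0 ->
  (forall x, 0 <= f x) -> (forall x, 0 <= g x) ->
  (forall x, ~ N x -> f x <= g x) -> \int[mu]_x f x <= \int[mu]_x g x.
Proof.
move=> mN N0 f0 g0 fg; rewrite !ge0_integralTE//.
apply: ge_ereal_sup => _ [h /= hf <-].
have mNc : measurable (~` N) by exact: measurableC.
apply: ereal_sup_ubound; exists (proj_nnsfun h mNc).
  move=> x /=; rewrite mindicE; have [/set_mem xN|/negP xN] := boolP (x \in ~` N).
    by rewrite mulr1 (le_trans (hf x))// fg.
  by rewrite mulr0.
rewrite -!integralT_nnsfun -mrestrict.
rewrite [RHS](@ge0_negligible_integral _ _ _ mu setT N)//=; last 2 first.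
  exact/measurable_EFinP.
  by move=> x _; rewrite lee_fin.
rewrite setTD [RHS]integral_mkcond; apply: eq_integral => x _.
by rewrite /= !patchE; case: ifP.
Qed.

Lemma eq_integral_off_null N f g : measurable N -> mu N = 0 ->
  (forall x, ~ N x -> f x = g x) -> \int[mu]_x f x = \int[mu]_x g x.
Proof.
move=> mN N0 fg; rewrite integralE [RHS]integralE.
by congr (_ - _); apply/eqP; rewrite eq_le; apply/andP; split;
  apply: (ge0_le_integral_off_null mN N0) => // x Nx;
  rewrite ?funeposE ?funenegE fg.
Qed.

(** The integral of f is finite and can be cancelled, so g - f is nonnegative with integral 0 and
    vanishes almost everywhere on A. *)
Lemma null_lt_of_le_integral (A B : set T) (f g : T -> R) : measurable A ->
  measurable B -> B `<=` A ->
  measurable_fun A f -> measurable_fun A g ->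
  (forall x, A x -> 0 <= f x <= g x)%R -> (forall x, B x -> f x < g x)%R ->
  \int[mu]_(x in A) (f x)%:E < +oo ->
  \int[mu]_(x in A) (g x)%:E <= \int[mu]_(x in A) (f x)%:E -> mu B = 0.
Proof.
move=> mA mB BA mf mg fg fgB foo gf.
have mgf : measurable_fun A (fun x => (g x - f x)%:E).
  exact/measurable_EFinP/measurable_funB.
have E : \int[mu]_(x in A) (g x)%:E =
    \int[mu]_(x in A) (g x - f x)%:E + \int[mu]_(x in A) (f x)%:E.
  rewrite -ge0_integralD//; last 3 first.
  - by move=> x /fg/andP[_ h]; rewrite lee_fin subr_ge0.
  - by move=> x /fg/andP[h _]; rewrite lee_fin.
  - exact/measurable_EFinP.
  by apply: eq_integral => x _; rewrite -EFinD subrK.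
have f0 : 0 <= \int[mu]_(x in A) (f x)%:E.
  by apply: integral_ge0 => x /fg/andP[h _]; rewrite lee_fin.
have ffin : \int[mu]_(x in A) (f x)%:E \is a fin_num by rewrite ge0_fin_numE.
have I0 : \int[mu]_(x in A) `|(g x - f x)%:E| = 0.
  transitivity (\int[mu]_(x in A) (g x - f x)%:E).
    apply: eq_integral => x /set_mem/fg/andP[_ h].
    by rewrite gee0_abs// lee_fin subr_ge0.
  apply/eqP; rewrite eq_le; apply/andP; split.
    by move: gf; rewrite E -[leRHS]add0e leeD2rE.
  by apply: integral_ge0 => x /fg/andP[_ h]; rewrite lee_fin subr_ge0.
have /ae_eq_integral_abs[//|//|N [mN N0 AN]] := I0.
apply: (subset_measure0 mB mN _ N0) => x Bx; apply: AN => /= /(_ (BA _ Bx))[].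
by move/eqP; rewrite subr_eq0 gt_eqF// fgB.
Qed.

Lemma null_of_lt_integral (A : set T) (f g : T -> R) : measurable A ->
  measurable_fun A f -> measurable_fun A g ->
  (forall x, A x -> 0 <= f x < g x)%R ->
  \int[mu]_(x in A) (f x)%:E < +oo ->
  \int[mu]_(x in A) (g x)%:E <= \int[mu]_(x in A) (f x)%:E -> mu A = 0.
Proof.
move=> mA mf mg fg; apply: null_lt_of_le_integral => // x /fg/andP[f0 flt] //.
by rewrite f0 ltW.
Qed.

End off_null.

Section mixture.
Local Open Scope ereal_scope.
Context d1 d2 (T : measurableType d1) (X : measurableType d2) (R : realType).
Implicit Types (w : T -> R) (k : T -> probability X R).

Section weighted_kernel.
Variables (w : T -> {nonneg R}) (k : T -> probability X R).
Hypothesis w1 : forall t, ((w t)%:num <= 1)%R.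

(** Weights at most 1 keep the scaled kernel a subprobability, hence a point of [giry X R], so that
    mixing over t becomes a monadic bind. *)
Definition weighted_kernel (t : T) : set X -> \bar R := mscale (w t) (k t).

HB.instance Definition _ t := Measure.on (weighted_kernel t).

Let weighted_kernel_setT t : weighted_kernel t setT <= 1.
Proof.
by rewrite /weighted_kernel /mscale [X in _ * X]probability_setT mule1 lee_fin.
Qed.

HB.instance Definition _ t := Measure_isSubProbability.Build _ _ _
  (weighted_kernel t) (weighted_kernel_setT t).

Definition giry_weighted_kernel (t : T) : giry X R := weighted_kernel t.

End weighted_kernel.

Lemma weighted_mixture1 (mu : giry T R) w k :
  measurable_fun setT w -> (forall t, 0 <= w t <= 1)%R ->
  (forall A, measurable A -> measurable_fun setT (k ^~ A)) ->
  exists nu : giry X R, forall h : X -> \bar R, measurable_fun setT h ->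
    (forall x, 0 <= h x) ->
    \int[nu]_x h x = \int[mu]_t ((w t)%:E * \int[k t]_x h x).
Proof.
move=> mw w01 mk.
have w0 t : (0 <= w t)%R by case/andP: (w01 t).
pose wn t : {nonneg R} := NngNum (w0 t).
have wn1 t : ((wn t)%:num <= 1)%R by case/andP: (w01 t).
pose K t : giry X R := giry_weighted_kernel k wn1 t.
have mK : measurable_fun setT K.
  apply: measurable_giry_codensity => // A mA.
  rewrite (_ : (fun _ => _) = (fun t => (w t)%:E * k t A))//.
  apply: emeasurable_funM; [exact/measurable_EFinP|exact: mk].
exists (giry_bind mu mK) => h mh h0.
have := giry_int_bind mu mK mh h0; rewrite /giry_int => ->.
by apply: eq_integral => t _; rewrite ge0_integral_mscale.
Qed.

(** Divide the weights by their bound B to land in the subprobability case, then scale the resulting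
    measure back by B. *)
Lemma weighted_mixture (mu : giry T R) w k (B : R) :
  measurable_fun setT w -> (forall t, 0 <= w t <= B)%R -> (0 < B)%R ->
  (forall A, measurable A -> measurable_fun setT (k ^~ A)) ->
  exists nu : {measure set X -> \bar R}, forall h : X -> \bar R,
    measurable_fun setT h -> (forall x, 0 <= h x) ->
    \int[nu]_x h x = \int[mu]_t ((w t)%:E * \int[k t]_x h x).
Proof.
move=> mw wB B0 mk.
have wB1 t : (0 <= w t / B <= 1)%R.
  have /andP[h1 h2] := wB t.
  by rewrite divr_ge0 ?(ltW B0)//= ler_pdivrMr// mul1r.
have mwB : measurable_fun setT (fun t => w t / B)%R by exact: measurable_funM.
have [nu nuE] := weighted_mixture1 mu mwB wB1 mk.
exists (mscale (NngNum (ltW B0)) nu) => h mh h0.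
rewrite ge0_integral_mscale//= nuE// -ge0_integralZl//; last 3 first.
- apply: emeasurable_funM; first exact/measurable_EFinP.
  exact: measurable_fun_integral_kernel.
- move=> t _; apply: mule_ge0; last by apply: integral_ge0.
  by rewrite lee_fin; case/andP: (wB1 t).
- by rewrite lee_fin ltW.
apply: eq_integral => t _; rewrite muleA -EFinM; congr (_%:E * _).
by rewrite mulrC divfK// gt_eqF.
Qed.

End mixture.

(** Each side is the integral of h against one measure on X. The two measures agree on events, hence
    so do the integrals; later identities need to be checked on events only. *)
Lemma weighted_integral_ext d1 d2 d3 (T1 : measurableType d1)
    (T2 : measurableType d2) (X : measurableType d3) (R : realType)
    (mu1 : giry T1 R) (mu2 : giry T2 R) (w1 : T1 -> R) (w2 : T2 -> R) (B : R)
    (k1 : T1 -> probability X R) (k2 : T2 -> probability X R) :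
  measurable_fun setT w1 -> (forall t, 0 <= w1 t <= B) ->
  measurable_fun setT w2 -> (forall t, 0 <= w2 t <= B) -> 0 < B ->
  (forall A, measurable A -> measurable_fun setT (k1 ^~ A)) ->
  (forall A, measurable A -> measurable_fun setT (k2 ^~ A)) ->
  (forall A, measurable A ->
    \int[mu1]_t ((w1 t)%:E * k1 t A) = \int[mu2]_t ((w2 t)%:E * k2 t A))%E ->
  forall h : X -> \bar R, measurable_fun setT h -> (forall x, 0 <= h x)%E ->
  (\int[mu1]_t ((w1 t)%:E * \int[k1 t]_x h x) =
   \int[mu2]_t ((w2 t)%:E * \int[k2 t]_x h x))%E.
Proof.
move=> mw1 w1B mw2 w2B B0 mk1 mk2 E h mh h0.
have [n1 n1E] := weighted_mixture mu1 mw1 w1B B0 mk1.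
have [n2 n2E] := weighted_mixture mu2 mw2 w2B B0 mk2.
rewrite -n1E// -n2E//; apply: eq_measure_integral => A mA _.
have mI : measurable_fun setT (EFin \o \1_A : X -> \bar R).
  exact/measurable_EFinP/measurable_indic.
have I0 x : (0 <= (EFin \o \1_A : X -> \bar R) x)%E by rewrite lee_fin.
have := n1E _ mI I0; have := n2E _ mI I0.
rewrite /= !integral_indic// !setIT => -> ->.
under eq_integral do rewrite integral_indic// setIT.
rewrite E//.
by under [RHS]eq_integral do rewrite integral_indic// setIT.
Qed.

Lemma dirac_kernel_measurable d (X : measurableType d) (R : realType)
    (A : set X) : measurable A ->
  measurable_fun setT (fun x : X => (dirac x : probability X R) A).
Proof. by move=> mA; exact: measurable_fun_dirac. Qed.

(** * Projection onto an interval *)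

Definition clamp (R : realType) (a b t : R) : R := Num.max a (Num.min b t).

Section clamp.
Context (R : realType) (a b : R).
Hypothesis ab : a < b.

Lemma clamp_in t : clamp a b t \in `[a, b].
Proof.
by rewrite in_itv/= /clamp le_max lexx/= ge_max ge_min lexx (ltW ab).
Qed.

Lemma clamp_id t : t \in `[a, b] -> clamp a b t = t.
Proof.
by rewrite in_itv/= => /andP[at_ tb]; rewrite /clamp min_r// max_r.
Qed.

Lemma clamp_nondecreasing : {homo clamp a b : x y / x <= y}.
Proof.
move=> x y xy; rewrite /clamp ge_max le_max lexx/= le_max; apply/orP; right.
by rewrite le_min !ge_min lexx xy orbT.
Qed.

Lemma measurable_clamp : measurable_fun setT (clamp a b).
Proof. exact: nondecreasing_measurable clamp_nondecreasing. Qed.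

(** Extending a monotone function on [a, b] by constants keeps it monotone, hence measurable on the
    whole line. *)
Lemma measurable_clamp_comp (g : R -> R) :
  {in `[a, b] &, {homo g : x y / x <= y}} ->
  measurable_fun setT (g \o clamp a b).
Proof.
move=> gh; apply: nondecreasing_measurable => // x y xy /=.
by apply: gh; [exact: clamp_in|exact: clamp_in|exact: clamp_nondecreasing].
Qed.

End clamp.

(** * Posterior means and garblings *)

Section posterior.
Context (R : realType) (ql qh : R) (mu : probability R R)
  (d : measure_display) (X : measurableType d)
  (pi : R -> probability X R) (m : X -> R).
Hypothesis ql_gt0 : 0 < ql.
Hypothesis ql_lt_qh : ql < qh.
Hypothesis mu_supp : mu `[ql, qh]%classic = 1%E.
Hypothesis pi_kernel : is_info_kernel pi.
Local Open Scope ereal_scope.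

Local Notation Q := (`[ql, qh]%classic : set R).
Local Notation kap := (clamp ql qh).

Let qh_gt0 : (0 < qh)%R. Proof. exact: lt_trans ql_lt_qh. Qed.

Lemma prior_off_null : mu (~` Q) = 0.
Proof. by rewrite probability_setC// mu_supp subee. Qed.

Lemma eq_prior_integral (g h : R -> \bar R) :
  (forall q, q \in `[ql, qh] -> g q = h q) -> \int[mu]_q g q = \int[mu]_q h q.
Proof.
move=> gh; apply: (@eq_integral_off_null _ _ _ mu (~` Q)).
- exact: measurableC.
- exact: prior_off_null.
- by move=> x /contrapT/= /gh.
Qed.

(** nu is the marginal law of the signal, the mixture of pi with constant weight 1. *)
Lemma signal_law : exists nu : giry X R,
  forall h : X -> \bar R, measurable_fun setT h -> (forall x, 0 <= h x) ->
    \int[nu]_x h x = \int[mu]_q \int[pi q]_x h x.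
Proof.
have [||nu nuE] := @weighted_mixture1 _ _ _ _ _ (mu : giry _ R) (cst 1%R) pi _ _ pi_kernel.
- exact: measurable_cst.
- by move=> t; rewrite /= ler01 lexx.
exists nu => h mh h0; rewrite nuE//.
by apply: eq_integral => q _; rewrite mul1e.
Qed.

Variable nu : giry X R.
Hypothesis nuE : forall h : X -> \bar R, measurable_fun setT h ->
  (forall x, 0 <= h x) -> \int[nu]_x h x = \int[mu]_q \int[pi q]_x h x.

Lemma signal_lawE A : measurable A -> nu A = \int[mu]_q pi q A.
Proof.
move=> mA.
have /= := @nuE (EFin \o \1_A); rewrite integral_indic// setIT => ->.
- by apply: eq_integral => q _; rewrite integral_indic// setIT.
- exact/measurable_EFinP/measurable_indic.
- by move=> x; rewrite lee_fin.
Qed.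

Lemma signal_law_restr A (h : X -> \bar R) : measurable A ->
  measurable_fun A h -> (forall x, A x -> 0 <= h x) ->
  \int[nu]_(x in A) h x = \int[mu]_q \int[pi q]_(x in A) h x.
Proof.
move=> mA mh h0; rewrite integral_mkcond nuE.
- by apply: eq_integral => q _; rewrite [RHS]integral_mkcond.
- by apply/(measurable_restrictT _ mA).
- by move=> x; rewrite patchE; case: ifPn => // /set_mem/h0.
Qed.

(** A set of signals that is null for the marginal law is null for pi q at almost every q. No
    measurability of g or h is asked, so that g may involve p outside Q. *)
Lemma signal_law_null A (g h : X -> \bar R) : measurable A -> nu A = 0 ->
  (forall x, ~ A x -> g x = h x) ->
  \int[mu]_q \int[pi q]_x g x = \int[mu]_q \int[pi q]_x h x.
Proof.
move=> mA A0 gh.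
have : \int[mu]_q `|pi q A| = 0.
  rewrite -A0 signal_lawE//; apply: eq_integral => q _.
  by rewrite gee0_abs// measure_ge0.
move/(@ae_eq_integral_abs _ _ _ mu setT measurableT (pi ^~ A) (pi_kernel mA)).
move=> [N [mN N0 sub]].
apply: (@eq_integral_off_null _ _ _ mu N) => // q Nq.
apply: (@eq_integral_off_null _ _ _ (pi q) A) => //.
by apply: contra_notP Nq => h1; apply: sub => /= /(_ I).
Qed.

Hypothesis m_post : is_posterior_mean mu pi m.

Let mm : measurable_fun setT m. Proof. by case: m_post. Qed.

Lemma posterior_restr A : measurable A -> (forall x, A x -> 0 <= m x)%R ->
  \int[nu]_(x in A) (m x)%:E = \int[mu]_q ((kap q)%:E * pi q A).
Proof.
move=> mA m0; rewrite signal_law_restr//; last first.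
  by apply/measurable_EFinP; exact: measurable_funS mm.
case: m_post => _ [_ ->]//; apply: eq_prior_integral => q qQ.
by rewrite integral_cst// clamp_id.
Qed.

Let mkap A : measurable A -> measurable_fun setT (fun q => (kap q)%:E * pi q A).
Proof.
move=> mA; apply: emeasurable_funM; last exact: pi_kernel.
by apply/measurable_EFinP; exact: measurable_clamp.
Qed.

Lemma posterior_bounds A : measurable A ->
  ql%:E * nu A <= \int[mu]_q ((kap q)%:E * pi q A) <= qh%:E * nu A.
Proof.
move=> mA; rewrite signal_lawE// -!ge0_integralZl//; last 4 first.
- exact: pi_kernel.
- by rewrite lee_fin ltW.
- exact: pi_kernel.
- by rewrite lee_fin ltW.
have kap_itv q : (ql <= kap q <= qh)%R.
  by have := clamp_in ql_lt_qh q; rewrite in_itv.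
apply/andP; split; apply: ge0_le_integral => //.
- by move=> q _; rewrite mule_ge0// lee_fin ltW.
- by apply: emeasurable_funM => //; exact: pi_kernel.
- exact: mkap.
- move=> q _; rewrite lee_wpmul2r// lee_fin.
  by case/andP: (kap_itv q).
- move=> q _; rewrite mule_ge0// lee_fin.
  by case/andP: (kap_itv q) => h _; exact: le_trans (ltW ql_gt0) h.
- exact: mkap.
- by apply: emeasurable_funM => //; exact: pi_kernel.
- move=> q _; rewrite lee_wpmul2r// lee_fin.
  by case/andP: (kap_itv q).
Qed.

Let nu_fin A : measurable A -> nu A < +oo.
Proof.
move=> mA; apply: (@le_lt_trans _ _ 1); last by rewrite ltry.
apply: le_trans (@sprobability_setT _ _ _ nu).
by apply: le_measure; rewrite ?inE.
Qed.

(** On the event m < ql the integrals of m and of q coincide, yet the latter is at least ql times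
    the mass, so the mass is 0; the event m > qh is symmetric. Negative values of m are treated
    apart because the comparison lemmas need nonnegative integrands. *)
Lemma posterior_in_support : nu (m @^-1` ~` Q) = 0.
Proof.
have mpre (B : set R) : measurable B -> measurable (m @^-1` B).
  by move=> mB; rewrite -[_ @^-1` _]setTI; exact: mm.
pose A1 := m @^-1` `]-oo, 0%R[; pose A2 := m @^-1` `[0%R, ql[.
pose A3 := m @^-1` `]qh, +oo[.
have mA1 : measurable A1 by exact: mpre.
have mA2 : measurable A2 by exact: mpre.
have mA3 : measurable A3 by exact: mpre.
have mres A : measurable_fun A m by exact: measurable_funS mm.
have icst (r : R) A : measurable A ->
    \int[nu]_(x in A) (cst r x)%:E = r%:E * nu A.
  by move=> mA; have := integral_cst nu mA r%:E.
(* Here 0 is compared with - m, whose integral over A1 is minus that of q and so cannot be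
   positive. *)
have z1 : nu A1 = 0.
  apply: (@null_of_lt_integral _ _ _ _ A1 (cst 0%R) (fun x => - m x)%R) => //.
  - exact: measurableT_comp (mres A1).
  - by move=> x; rewrite /A1/= in_itv/= => h; rewrite lexx oppr_gt0.
  - by rewrite integral0.
  rewrite integral0 signal_law_restr//; last 2 first.
  - by apply/measurable_EFinP; exact: measurableT_comp (mres A1).
  - by move=> x; rewrite /A1/= in_itv/= lee_fin oppr_ge0 => /ltW.
  case: m_post => _ [_ /(_ _ mA1) E].
  have Ein q : \int[pi q]_(x in A1) (m x)%:E = - \int[pi q]_(x in A1) (- m x)%:E.
    rewrite -integral_ge0N; last first.
      by move=> x; rewrite /A1/= in_itv/= lee_fin oppr_ge0 => /ltW.
    by apply: eq_integral => x _; rewrite -EFinN opprK.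
  move: E; under eq_integral do rewrite Ein.
  rewrite integral_ge0N; last first.
    move=> q _; apply: integral_ge0 => x.
    by rewrite /A1/= in_itv/= lee_fin oppr_ge0 => /ltW.
  move=> E; rewrite -oppe_ge0 E.
  rewrite (@eq_prior_integral _ (fun q => (kap q)%:E * pi q A1)).
    apply: integral_ge0 => q _; rewrite mule_ge0// lee_fin.
    have := clamp_in ql_lt_qh q; rewrite in_itv/= => /andP[h _].
    exact: le_trans (ltW ql_gt0) h.
  by move=> q qQ; rewrite integral_cst// clamp_id.
have z2 : nu A2 = 0.
  have A20 x : A2 x -> (0 <= m x < ql)%R by rewrite /A2/= in_itv.
  have E := @posterior_restr A2 mA2 (fun x h => proj1 (andP (A20 x h))).
  have /andP[B1 B2] := posterior_bounds mA2.
  apply: (@null_of_lt_integral _ _ _ _ A2 m (cst ql)) => //.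
  - by rewrite E (le_lt_trans B2)// lte_mul_pinfty// ?lee_fin ?(ltW qh_gt0)// nu_fin.
  - by rewrite icst// E.
have z3 : nu A3 = 0.
  have A30 x : A3 x -> (qh < m x)%R by rewrite /A3/= in_itv/= andbT.
  have A30' x : A3 x -> (0 <= m x)%R by move=> /A30 h; rewrite ltW// (lt_trans qh_gt0).
  have E := @posterior_restr A3 mA3 A30'.
  have /andP[B1 B2] := posterior_bounds mA3.
  apply: (@null_of_lt_integral _ _ _ _ A3 (cst qh) m) => //.
  - by move=> x /A30 h; rewrite h (ltW qh_gt0).
  - by rewrite icst// lte_mul_pinfty// ?lee_fin ?(ltW qh_gt0)// nu_fin.
  - by rewrite icst// E.
have -> : m @^-1` (~` Q) = A1 `|` A2 `|` A3.
  apply/seteqP; split => x; rewrite /A1 /A2 /A3/= !in_itv/= andbT.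
    move=> h; have [h1|h1] := ltP (m x) 0%R; first by left; left.
    have [h2|h2] := ltP (m x) ql; first by left; right.
    by right; rewrite ltNge; apply/negP => h3; apply: h; rewrite h2.
  move=> [[h|/andP[h1 h2]]|h]; apply/negP; rewrite negb_and -!ltNge.
  - by rewrite (lt_trans h ql_gt0).
  - by rewrite h2.
  - by rewrite h orbT.
by rewrite measureU0// ?measureU0//; exact: measurableU.
Qed.

(** Meant for g = [buyer_util f p], uncontrolled outside Q, and gc a replacement that is measurable
    after clamping; signals with posterior mean outside Q are null. *)
Lemma posterior_payoff (g gc : R -> \bar R) :
  (forall t, t \in `[ql, qh] -> g t = gc t) ->
  measurable_fun setT (gc \o kap) -> (forall t, 0 <= gc (kap t)) ->
  \int[mu]_q \int[pi q]_x g (m x) = \int[nu]_x gc (kap (m x)).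
Proof.
move=> ggc mg g0.
have mgm : measurable_fun setT (fun x => gc (kap (m x))).
  exact: (measurableT_comp mg mm).
rewrite (nuE mgm (fun x => g0 (m x))).
apply: signal_law_null posterior_in_support _.
  by rewrite -[_ @^-1` _]setTI; apply: mm => //; exact: measurableC.
by move=> x /contrapT/= xQ; rewrite clamp_id// ggc.
Qed.

(** The defining property of the posterior mean, carried from events to test functions. Inserting a
    Dirac kernel on the left turns both sides into weighted mixtures for [weighted_integral_ext]. *)
Lemma posterior_mean_integral (h : X -> \bar R) : measurable_fun setT h ->
  (forall x, 0 <= h x) ->
  \int[nu]_x ((kap (m x))%:E * h x) = \int[mu]_q ((kap q)%:E * \int[pi q]_x h x).
Proof.
move=> mh h0.
have mkm : measurable_fun setT (fun x => kap (m x)).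
  by apply: measurableT_comp mm; exact: measurable_clamp.
have kap_itv q : (0 <= kap q <= qh)%R.
  have := clamp_in ql_lt_qh q; rewrite in_itv/= => /andP[h1 ->].
  by rewrite (le_trans (ltW ql_gt0)).
transitivity (\int[nu]_x ((kap (m x))%:E * \int[dirac x]_y h y)).
  by apply: eq_integral => x _; rewrite integral_dirac// diracT mul1e.
apply: (@weighted_integral_ext _ _ _ _ _ _ _ nu (mu : giry _ R) _ _ qh
  (fun x => (dirac x : probability X R)) pi) => //.
- exact: measurable_clamp.
- exact: dirac_kernel_measurable.
move=> A mA.
have mN : measurable (m @^-1` ~` Q).
  by rewrite -[_ @^-1` _]setTI; apply: mm => //; exact: measurableC.
transitivity (\int[nu]_x (((kap (m x))%:E * \d_x A))); first by [].
rewrite nuE; last 2 first.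
- apply: emeasurable_funM; last exact: dirac_kernel_measurable.
  by apply/measurable_EFinP.
- by move=> x; rewrite mule_ge0// lee_fin; case/andP: (kap_itv (m x)).
transitivity (\int[mu]_q \int[pi q]_(x in A) (m x)%:E).
  under [RHS]eq_integral do rewrite integral_mkcond.
  apply: (@signal_law_null _ _ _ mN posterior_in_support).
  move=> x /contrapT/= xQ; rewrite clamp_id// diracE patchE.
  by case: ifP => _; rewrite ?mule1 ?mule0.
case: m_post => _ [_ ->]//; apply: eq_prior_integral => q qQ.
by rewrite integral_cst// clamp_id.
Qed.

End posterior.

(* Jensen's inequality without conditional expectations: integrate the tangent
   inequality [U (M x) + D (M x) (M' x' - M x) <= U (M' x')] against the joint law
   [nu' (dx') g x' (dx)]; the linear term integrates to [0] by [gM].  The constant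
   [C] only serves to make all integrands nonnegative. *)
Lemma kernel_jensen (R : realType) (d d' : measure_display)
    (X : measurableType d) (X' : measurableType d')
    (nu : giry X R) (nu' : giry X' R) (g : X' -> probability X R)
    (M : X -> R) (M' : X' -> R) (U D : R -> R) (a b B C : R) :
  (forall A, measurable A -> measurable_fun setT (g ^~ A)) ->
  measurable_fun setT M -> measurable_fun setT M' ->
  measurable_fun setT (U \o M) -> measurable_fun setT (U \o M') ->
  measurable_fun setT (D \o M) ->
  0 <= a -> 0 <= C ->
  (forall x, M x \in `[a, b]) -> (forall x', M' x' \in `[a, b]) ->
  (forall t, t \in `[a, b] -> 0 <= U t) ->
  (forall t, t \in `[a, b] -> 0 <= D t + C <= B) ->
  (forall s t, s \in `[a, b] -> t \in `[a, b] -> U t + D t * (s - t) <= U s) ->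
  (forall h : X -> \bar R, measurable_fun setT h -> (forall x, 0 <= h x)%E ->
    \int[nu]_x h x = \int[nu']_x' \int[g x']_x h x)%E ->
  (forall h : X -> \bar R, measurable_fun setT h -> (forall x, 0 <= h x)%E ->
    \int[nu]_x ((M x)%:E * h x) = \int[nu']_x' ((M' x')%:E * \int[g x']_x h x))%E ->
  (\int[nu]_x (U (M x))%:E <= \int[nu']_x' (U (M' x'))%:E)%E.
Proof.
move=> mg mM mM' mUM mUM' mDM a0 C0 MI MI' U0 DC tgt gnu gM.
have M0 x : 0 <= M x.
  by have := MI x; rewrite in_itv/= => /andP[h _]; exact: le_trans h.
have M0' x : 0 <= M' x.
  by have := MI' x; rewrite in_itv/= => /andP[h _]; exact: le_trans h.
have Mb x : M x <= b by have := MI x; rewrite in_itv/= => /andP[].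
pose E x := D (M x) + C.
have E0 x : 0 <= E x by have /andP[] := DC _ (MI x).
have EB x : E x <= B by have /andP[] := DC _ (MI x).
pose phi x := U (M x) + C * M x.
pose om x' := U (M' x') + C * M' x'.
have phi0 x : 0 <= phi x by rewrite addr_ge0 ?U0// mulr_ge0.
have om0 x : 0 <= om x by rewrite addr_ge0 ?U0// mulr_ge0.
have chi0 x : 0 <= M x * E x by rewrite mulr_ge0.
have mE : measurable_fun setT E by apply: measurable_funD.
have mphi : measurable_fun setT phi.
  by apply: measurable_funD => //; exact: measurable_funM.
have mom : measurable_fun setT om.
  by apply: measurable_funD => //; exact: measurable_funM.
have mchi : measurable_fun setT (fun x => M x * E x) by exact: measurable_funM.
have emE : measurable_fun setT (EFin \o E) by exact/measurable_EFinP.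
have emphi : measurable_fun setT (EFin \o phi) by exact/measurable_EFinP.
have emom : measurable_fun setT (EFin \o om) by exact/measurable_EFinP.
have emchi : measurable_fun setT (EFin \o (fun x => M x * E x)).
  exact/measurable_EFinP.
(* The tangent inequality with C added to the slope and every negative term moved across: phi x + M'
   x' * E x <= om x' + M x * E x. *)
have key x' : (\int[g x']_x (phi x)%:E + (M' x')%:E * \int[g x']_x (E x)%:E <=
    (om x')%:E + \int[g x']_x (M x * E x)%:E)%E.
  have -> : (om x')%:E = (\int[g x']_x (cst (om x')%:E) x)%E.
    by rewrite integral_cst// [X in (_ * X)%E]probability_setT mule1.
  rewrite -ge0_integralZl//; last 2 first.
    by move=> x _; rewrite lee_fin.
    by rewrite lee_fin.
  rewrite -ge0_integralD//; last 3 first.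
    by move=> x _; rewrite lee_fin.
    by move=> x _; rewrite mule_ge0// lee_fin.
    by apply: emeasurable_funM.
  rewrite -ge0_integralD//; last 2 first.
    by move=> x _; rewrite lee_fin.
    by move=> x _; rewrite lee_fin mulr_ge0.
  apply: ge0_le_integral => //.
  - by move=> x _; rewrite adde_ge0 ?mule_ge0// lee_fin.
  - by apply: emeasurable_funD => //; exact: emeasurable_funM.
  - by apply: emeasurable_funD.
  move=> x _; rewrite -EFinM -!EFinD lee_fin /phi /om /E.
  have := tgt _ _ (MI' x') (MI x); lra.
have mint (h : X -> \bar R) : measurable_fun setT h -> (forall x, 0 <= h x)%E ->
    measurable_fun setT (fun x' => \int[g x']_x h x)%E.
  by move=> mh h0; exact: measurable_fun_integral_kernel.
(* By [gM] the cross terms M E and M' E have the same total integral; its finiteness allows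
   cancelling it. *)
have chi_fin : (\int[nu]_x (M x * E x)%:E \is a fin_num)%E.
  rewrite ge0_fin_numE; last by apply: integral_ge0 => x _; rewrite lee_fin mulr_ge0.
  apply: (@le_lt_trans _ _ (\int[nu]_x (cst (b * B)%:E x))%E).
    apply: ge0_le_integral => //.
    - by move=> x _; rewrite lee_fin mulr_ge0.
    - by move=> x _; rewrite lee_fin ler_pM.
  rewrite integral_cst//= (@le_lt_trans _ _ (`|b * B|%:E * 1)%E) ?mule1 ?ltry//.
  rewrite (@le_trans _ _ (`|b * B|%:E * nu setT)%E)//.
    by rewrite lee_wpmul2r// lee_fin ler_norm.
  rewrite -[leRHS]mule1 lee_wpmul2l ?lee_fin//.
  exact: sprobability_setT.
(* The test function 1 shows that both posterior means have the same expectation, so the C terms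
   cancel at the end. *)
have M_eq : (\int[nu]_x (M x)%:E = \int[nu']_x' (M' x')%:E)%E.
  have := gM (cst 1%E) (measurable_cst _) (fun=> lee01).
  under eq_integral do rewrite mule1.
  move=> ->; apply: eq_integral => x' _.
  by rewrite integral_cst// mul1e [X in (_ * X)%E]probability_setT mule1.
have M_fin : (\int[nu]_x (M x)%:E \is a fin_num)%E.
  rewrite ge0_fin_numE; last by apply: integral_ge0 => x _; rewrite lee_fin.
  apply: (@le_lt_trans _ _ (\int[nu]_x (cst b%:E x))%E).
    apply: ge0_le_integral => //.
    - by move=> x _; rewrite lee_fin.
    - exact/measurable_EFinP.
    - by move=> x _; rewrite lee_fin.
  rewrite integral_cst//= (@le_lt_trans _ _ (`|b|%:E * 1)%E) ?mule1 ?ltry//.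
  rewrite (@le_trans _ _ (`|b|%:E * nu setT)%E)//.
    by rewrite lee_wpmul2r// lee_fin ler_norm.
  rewrite -[leRHS]mule1 lee_wpmul2l ?lee_fin//.
  exact: sprobability_setT.
have main : (\int[nu]_x (phi x)%:E <= \int[nu']_x' (om x')%:E)%E.
  rewrite -(leeD2rE _ _ chi_fin).
  have -> : (\int[nu]_x (phi x)%:E + \int[nu]_x (M x * E x)%:E =
     \int[nu']_x' (\int[g x']_x (phi x)%:E + (M' x')%:E * \int[g x']_x (E x)%:E))%E.
    rewrite ge0_integralD//; last 4 first.
    - by move=> x' _; apply: integral_ge0 => x _; rewrite lee_fin.
    - by apply: mint => // x; rewrite lee_fin.
    - move=> x' _; rewrite mule_ge0 ?lee_fin//.
      by apply: integral_ge0 => x _; rewrite lee_fin.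
    - apply: emeasurable_funM; first exact/measurable_EFinP.
      by apply: mint => // x; rewrite lee_fin.
    by rewrite -gnu// -gM.
  have -> : (\int[nu']_x' (om x')%:E + \int[nu]_x (M x * E x)%:E =
      \int[nu']_x' ((om x')%:E + \int[g x']_x (M x * E x)%:E))%E.
    rewrite ge0_integralD//; last 3 first.
    - by move=> x' _; rewrite lee_fin.
    - by move=> x' _; apply: integral_ge0 => x _; rewrite lee_fin mulr_ge0.
    - by apply: mint => // x; rewrite lee_fin mulr_ge0.
    by rewrite -gnu.
  apply: ge0_le_integral => //.
  - move=> x' _; rewrite adde_ge0 ?mule_ge0 ?lee_fin//.
      by apply: integral_ge0 => x _; rewrite lee_fin.
    by apply: integral_ge0 => x _; rewrite lee_fin.
  - apply: emeasurable_funD; first by apply: mint => // x; rewrite lee_fin.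
    apply: emeasurable_funM; first exact/measurable_EFinP.
    by apply: mint => // x; rewrite lee_fin.
  - apply: emeasurable_funD => //.
    by apply: mint => // x; rewrite lee_fin mulr_ge0.
have split1 : (\int[nu]_x (phi x)%:E =
    \int[nu]_x (U (M x))%:E + C%:E * \int[nu]_x (M x)%:E)%E.
  rewrite -ge0_integralZl//; last 2 first.
  - exact/measurable_EFinP.
  - by move=> x _; rewrite lee_fin.
  rewrite -ge0_integralD//.
  - by move=> x _; rewrite lee_fin U0.
  - exact/measurable_EFinP.
  - by move=> x _; rewrite mule_ge0// lee_fin.
  - by apply: emeasurable_funM => //; exact/measurable_EFinP.
have split2 : (\int[nu']_x (om x)%:E =
    \int[nu']_x (U (M' x))%:E + C%:E * \int[nu']_x (M' x)%:E)%E.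
  rewrite -ge0_integralZl//; last 2 first.
  - exact/measurable_EFinP.
  - by move=> x _; rewrite lee_fin.
  rewrite -ge0_integralD//.
  - by move=> x _; rewrite lee_fin U0.
  - exact/measurable_EFinP.
  - by move=> x _; rewrite mule_ge0// lee_fin.
  - by apply: emeasurable_funM => //; exact/measurable_EFinP.
move: main; rewrite split1 split2 -M_eq leeD2rE// fin_numM//.
Qed.

Section garbling.
Context (R : realType) (ql qh : R) (mu : probability R R)
  (d d' : measure_display) (X : measurableType d) (X' : measurableType d')
  (pi : R -> probability X R) (pi' : R -> probability X' R)
  (m : X -> R) (m' : X' -> R) (nu : giry X R) (nu' : giry X' R)
  (g : X' -> probability X R).
Hypothesis ql_gt0 : 0 < ql.
Hypothesis ql_lt_qh : ql < qh.
Hypothesis mu_supp : mu `[ql, qh]%classic = 1%E.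
Hypothesis pi_kernel : is_info_kernel pi.
Hypothesis pi_kernel' : is_info_kernel pi'.
Hypothesis m_post : is_posterior_mean mu pi m.
Hypothesis m_post' : is_posterior_mean mu pi' m'.
Local Open Scope ereal_scope.
Hypothesis nuE : forall h : X -> \bar R, measurable_fun setT h ->
  (forall x, 0 <= h x) -> \int[nu]_x h x = \int[mu]_q \int[pi q]_x h x.
Hypothesis nuE' : forall h : X' -> \bar R, measurable_fun setT h ->
  (forall x, 0 <= h x) -> \int[nu']_x h x = \int[mu]_q \int[pi' q]_x h x.
Hypothesis mg : forall A, measurable A -> measurable_fun setT (g ^~ A).
Hypothesis gE : forall q, q \in `[ql, qh] -> forall A, measurable A ->
  pi q A = \int[pi' q]_x' g x' A.
Local Notation kap := (clamp ql qh).

Let qh_gt0 : (0 < qh)%R. Proof. exact: lt_trans ql_lt_qh. Qed.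

Let kap_itv q : (0 <= kap q <= qh)%R.
Proof.
have := clamp_in ql_lt_qh q; rewrite in_itv/= => /andP[h1 ->].
by rewrite (le_trans (ltW ql_gt0)).
Qed.

Lemma garbling_integral (h : X -> \bar R) : measurable_fun setT h ->
  (forall x, 0 <= h x) -> \int[nu]_x h x = \int[nu']_x' \int[g x']_x h x.
Proof.
move=> mh h0.
transitivity (\int[nu]_x ((cst 1%R x)%:E * \int[dirac x]_y h y)).
  by apply: eq_integral => x _; rewrite integral_dirac// diracT !mul1e.
transitivity (\int[nu']_x' ((cst 1%R x')%:E * \int[g x']_y h y)); last first.
  by apply: eq_integral => x _; rewrite mul1e.
apply: (@weighted_integral_ext _ _ _ _ _ _ _ nu nu' _ _ 1%R
  (fun x => (dirac x : probability X R)) g) => //.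
- by move=> t /=; rewrite ler01 lexx.
- by move=> t /=; rewrite ler01 lexx.
- exact: dirac_kernel_measurable.
move=> A mA; under eq_integral do rewrite mul1e.
under [RHS]eq_integral do rewrite mul1e.
transitivity (nu A).
  by rewrite -[in RHS](setIT A) -integral_indic//; apply: eq_integral => x _.
rewrite (signal_lawE nuE)// nuE'//; last exact: mg.
by apply: (eq_prior_integral mu_supp) => q qQ; rewrite gE.
Qed.

(** The tower property E[m' | x] = m, tested against h. On an event both sides are the integral of q
    over it, computed once through pi and once through pi' followed by g. *)
Lemma garbling_posterior_integral (h : X -> \bar R) : measurable_fun setT h ->
  (forall x, 0 <= h x) ->
  \int[nu]_x ((kap (m x))%:E * h x) =
  \int[nu']_x' ((kap (m' x'))%:E * \int[g x']_x h x).
Proof.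
move=> mh h0.
have mm : measurable_fun setT m by case: m_post.
have mm' : measurable_fun setT m' by case: m_post'.
transitivity (\int[nu]_x ((kap (m x))%:E * \int[dirac x]_y h y)).
  by apply: eq_integral => x _; rewrite integral_dirac// diracT mul1e.
apply: (@weighted_integral_ext _ _ _ _ _ _ _ nu nu' _ _ qh
  (fun x => (dirac x : probability X R)) g) => //.
- by apply: measurableT_comp mm; exact: measurable_clamp.
- by apply: measurableT_comp mm'; exact: measurable_clamp.
- exact: dirac_kernel_measurable.
move=> A mA.
transitivity (\int[nu]_x ((kap (m x))%:E * (\1_A x)%:E)); first by [].
rewrite (posterior_mean_integral ql_gt0 ql_lt_qh mu_supp pi_kernel nuE m_post); last 2 first.
- exact/measurable_EFinP/measurable_indic.
- by move=> x; rewrite lee_fin.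
rewrite (posterior_mean_integral ql_gt0 ql_lt_qh mu_supp pi_kernel' nuE' m_post')//; last first.
  exact: mg.
apply: (eq_prior_integral mu_supp) => q qQ.
by rewrite -gE// integral_indic// setIT.
Qed.

End garbling.

Lemma dirac_kernel (R : realType) (s : R -> R) : measurable_fun setT s ->
  is_info_kernel (fun q => (dirac (s q) : probability R R)).
Proof.
move=> ms A mA.
exact: measurableT_comp (dirac_kernel_measurable mA) ms.
Qed.

Lemma ge0_integral_setC (d : measure_display) (T : measurableType d)
    (R : realType) (mu : {measure set T -> \bar R}) (I : set T)
    (k : T -> \bar R) : measurable I -> measurable_fun setT k ->
  (forall x, 0 <= k x)%E ->
  (\int[mu]_x k x = \int[mu]_(x in I) k x + \int[mu]_(x in ~` I) k x)%E.
Proof.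
move=> mI mk k0; rewrite -(setUv I) ge0_integral_setU//.
- exact: measurableC.
- by rewrite setUv.
- exact/disj_setPCl.
Qed.

(** * Pooling an interval of qualities *)

Section pooling.
Context (R : realType) (ql qh : R) (mu : probability R R) (I : set R) (qbar : R).
Hypothesis ql_gt0 : 0 < ql.
Hypothesis ql_lt_qh : ql < qh.
Hypothesis mu_supp : mu `[ql, qh]%classic = 1%E.
Hypothesis mI : measurable I.
Hypothesis qbarQ : qbar \in `[ql, qh].
Local Notation kap := (clamp ql qh).
Hypothesis qbarE :
  (\int[mu]_(q in I) (kap q)%:E = qbar%:E * mu I)%E.

(** Used as a deterministic signal: q is disclosed outside I, and the single message qbar is sent on
    I. *)
Definition pool (q : R) : R := if q \in I then qbar else q.

Lemma measurable_pool : measurable_fun setT pool.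
Proof.
apply: measurable_fun_ifT => //.
by apply: (measurable_fun_bool true); rewrite setTI (_ : _ @^-1` _ = I)//;
  apply/seteqP; split => x /=; [move/set_mem|move/mem_set].
Qed.

Lemma pool_integral (g h : R -> \bar R) : measurable_fun setT g ->
  measurable_fun setT h -> (forall q, 0 <= g q)%E -> (forall q, 0 <= h q)%E ->
  (forall q, ~ I q -> g q = h q) ->
  (\int[mu]_(q in I) g q = \int[mu]_(q in I) h q)%E ->
  (\int[mu]_q g q = \int[mu]_q h q)%E.
Proof.
move=> mg mh g0 h0 gh Igh.
rewrite (ge0_integral_setC mu mI mg)// (ge0_integral_setC mu mI mh)// Igh.
congr (_ + _)%E.
by apply: eq_integral => q /set_mem /gh.
Qed.

(** By [qbarE] the message qbar is the mean of q on I, so the signal is its own posterior mean. *)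
Lemma pool_posterior_mean :
  is_posterior_mean mu (fun q => (dirac (pool q) : probability R R)) id.
Proof.
have kap_itv q : 0 <= kap q <= qh.
  have := clamp_in ql_lt_qh q; rewrite in_itv/= => /andP[h1 ->].
  by rewrite (le_trans (ltW ql_gt0)).
have poolQ q : q \in `[ql, qh] -> pool q \in `[ql, qh].
  by rewrite /pool; case: ifP.
have mkp : measurable_fun setT (fun q => kap (pool q)).
  by apply: measurableT_comp measurable_pool; exact: measurable_clamp.
have mk : measurable_fun setT kap by exact: measurable_clamp.
split; first exact: measurable_id.
split.
  rewrite (eq_prior_integral mu_supp (h := fun q => (kap (pool q))%:E)).
    apply: (@le_lt_trans _ _ (\int[mu]_q (cst qh%:E q))%E).
      apply: ge0_le_integral => //.
      - by move=> q _; rewrite lee_fin; case/andP: (kap_itv (pool q)).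
      - exact/measurable_EFinP.
      - by move=> q _; rewrite lee_fin; case/andP: (kap_itv (pool q)).
    by rewrite integral_cst// [X in (_ * X)%E]probability_setT mule1 ltry.
  move=> q qQ; rewrite integral_dirac//; last first.
    by apply/measurable_EFinP; exact: normr_measurable.
  rewrite diracT mul1e clamp_id ?poolQ// ger0_norm//.
  have := poolQ q qQ; rewrite in_itv/= => /andP[h _].
  exact: le_trans (ltW ql_gt0) h.
move=> A mA.
have mdA : measurable_fun setT (fun q => \d_(pool q) A : \bar R)%E.
  exact: (dirac_kernel measurable_pool mA).
rewrite (eq_prior_integral mu_supp
  (h := fun q => (\d_(pool q) A * (kap (pool q))%:E)%E)); last first.
  by move=> q qQ; rewrite integral_dirac// clamp_id// poolQ.
rewrite [RHS](eq_prior_integral mu_supp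
  (h := fun q => (\d_(pool q) A * (kap q)%:E)%E)); last first.
  by move=> q qQ; rewrite integral_dirac// clamp_id.
apply: pool_integral.
- by apply: emeasurable_funM => //; exact/measurable_EFinP.
- by apply: emeasurable_funM => //; exact/measurable_EFinP.
- by move=> q; rewrite mule_ge0// lee_fin; case/andP: (kap_itv (pool q)).
- by move=> q; rewrite mule_ge0// lee_fin; case/andP: (kap_itv q).
- by move=> q Iq; rewrite /pool memNset.
(* On I the factor [\d_qbar A] is constant, and what remains is [qbarE]. *)
transitivity (\int[mu]_(q in I) (\d_qbar A * qbar%:E))%E.
  by apply: eq_integral => q qI; rewrite /pool qI clamp_id.
transitivity (\int[mu]_(q in I) (\d_qbar A * (kap q)%:E))%E; last first.
  by apply: eq_integral => q qI; rewrite /pool qI.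
have q0 : 0 <= qbar.
  move: qbarQ; rewrite in_itv/= => /andP[h _]; exact: le_trans (ltW ql_gt0) h.
have mkI : measurable_fun I (fun q => (kap q)%:E).
  by apply/measurable_EFinP; exact: measurable_funTS.
have k0 q : I q -> (0 <= (kap q)%:E)%E.
  by move=> _; rewrite lee_fin; case/andP: (kap_itv q).
have cstE : (\int[mu]_(q in I) qbar%:E = qbar%:E * mu I)%E.
  by have := integral_cst mu mI qbar%:E.
by rewrite ge0_integralZl// cstE -qbarE (ge0_integralZl _ mI mkI k0).
Qed.

End pooling.

Section concavity.
Context (R : realType) (ql qh q1 q2 : R) (mu : probability R R) (U D : R -> R).
Hypothesis ql_gt0 : 0 < ql.
Hypothesis ql_lt_qh : ql < qh.
Hypothesis q1_lt_q2 : q1 < q2.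
Hypothesis ql_le_q1 : ql <= q1.
Hypothesis q2_le_qh : q2 <= qh.
Hypothesis full_supp : forall x : R, x \in `[ql, qh] -> forall e : R, 0 < e ->
  (0 < mu `](x - e)%R, (x + e)%R[%classic)%E.
Local Notation kap := (clamp ql qh).
Local Notation I := (`]q1, q2[%classic : set R).

Let kap_id q : q \in `[q1, q2] -> kap q = q.
Proof.
rewrite in_itv/= => /andP[h1 h2]; apply: clamp_id.
by rewrite in_itv/= (le_trans ql_le_q1)// (le_trans h2).
Qed.

Lemma subinterval_measure_gt0 a b : q1 <= a -> a < b -> b <= q2 ->
  (0 < mu (`]a, b[%classic : set R))%E.
Proof.
move=> qa ab bq.
have lx : ql <= (a + b) / 2 by have := ql_le_q1; lra.
have xh : (a + b) / 2 <= qh by have := q2_le_qh; lra.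
have xQ : (a + b) / 2 \in `[ql, qh] by rewrite in_itv/= lx.
have e0 : 0 < (b - a) / 2 by lra.
have := full_supp xQ e0.
have -> : (a + b) / 2 - (b - a) / 2 = a by field.
by have -> : (a + b) / 2 + (b - a) / 2 = b by field.
Qed.

Let mI_fin : mu I \is a fin_num. Proof. exact: fin_num_measure. Qed.

Lemma pooled_mean_exists : exists2 qbar : R, qbar \in `[q1, q2] &
  (\int[mu]_(q in I) (kap q)%:E = qbar%:E * mu I)%E.
Proof.
have I0 : (0 < mu I)%E by apply: subinterval_measure_gt0.
have fI0 : 0 < fine (mu I) by rewrite fine_gt0// I0 ltey_eq mI_fin.
have mk : measurable_fun I (fun q => (kap q)%:E).
  by apply/measurable_EFinP; apply: measurable_funTS; exact: measurable_clamp.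
have kI q : I q -> q1 <= kap q <= q2.
  by rewrite /= in_itv/= => /andP[h1 h2]; rewrite kap_id ?in_itv/= ?ltW.
have k0 q : I q -> 0 <= kap q.
  move=> /kI/andP[h _]; apply: le_trans h; exact: le_trans (ltW ql_gt0) ql_le_q1.
have lo : (q1%:E * mu I <= \int[mu]_(q in I) (kap q)%:E)%E.
  rewrite -integral_cst//; apply: ge0_le_integral => //.
  - by move=> q _; rewrite lee_fin (le_trans (ltW ql_gt0)).
  - by move=> q /kI/andP[].
have hi : (\int[mu]_(q in I) (kap q)%:E <= q2%:E * mu I)%E.
  rewrite -integral_cst//; apply: ge0_le_integral => //.
  by move=> q /kI/andP[].
have Jfin : (\int[mu]_(q in I) (kap q)%:E)%E \is a fin_num.
  rewrite ge0_fin_numE; last by apply: integral_ge0 => q /k0.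
  by rewrite (le_lt_trans hi)// ltey_eq fin_numM.
exists (fine (\int[mu]_(q in I) (kap q)%:E)%E / fine (mu I)).
  move: lo hi; rewrite -(fineK Jfin) -(fineK mI_fin) -!EFinM !lee_fin => lo hi.
  by rewrite in_itv/= ler_pdivlMr// ler_pdivrMr// lo.
rewrite -{2}(fineK mI_fin) -EFinM divfK ?gt_eqF//.
by rewrite fineK.
Qed.

Hypothesis U_ge0 : forall t, t \in `[ql, qh] -> 0 <= U t.
Variable B : R.
Hypothesis U_le : forall t, t \in `[ql, qh] -> U t <= B.
Hypothesis U_meas : measurable_fun setT (U \o kap).
Hypothesis concave : forall s t, s \in `[q1, q2] -> t \in `[q1, q2] -> s != t ->
  U s < U t + D t * (s - t).

(** The tangent of U at qbar integrates over I to U(qbar) mu(I), as qbar is the mean there. If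
    pooling did not help, the gap between tangent and U, positive off qbar, would integrate to 0, so
    every part of I avoiding qbar would be null. *)
Lemma pooling_improves (qbar : R) : qbar \in `[q1, q2] ->
  (\int[mu]_(q in I) (kap q)%:E = qbar%:E * mu I)%E ->
  ~ (\int[mu]_q (U (kap (pool I qbar q)))%:E <= \int[mu]_q (U (kap q))%:E)%E.
Proof.
move=> qbarI qbarE le_int.
have qbarQ : qbar \in `[ql, qh].
  move: qbarI; rewrite !in_itv/= => /andP[h1 h2].
  by rewrite (le_trans ql_le_q1)// (le_trans h2).
have Ik t : I t -> t \in `[q1, q2].
  by rewrite /= !in_itv/= => /andP[h1 h2]; rewrite !ltW.
have subQ t : t \in `[q1, q2] -> t \in `[ql, qh].
  rewrite !in_itv/= => /andP[h1 h2].
  by rewrite (le_trans ql_le_q1)// (le_trans h2).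
have mIm : measurable I by [].
have mpool := measurable_pool qbar mIm.
have Uk0 t : 0 <= U (kap t) by apply: U_ge0; exact: clamp_in.
have q0 : 0 <= qbar.
  move: qbarQ; rewrite in_itv/= => /andP[h _]; exact: le_trans (ltW ql_gt0) h.
(* [w - u] is the gap between the tangent of [U] at [qbar] and [U]; the multiples
   of [ad] only make [u] and [w] nonnegative, and have equal integrals over [I]. *)
pose dd := D qbar; pose ad := `|dd|.
pose u q := U (kap q) + ad * kap q + ad * qbar.
pose w q := U qbar + (dd + ad) * kap q + (ad - dd) * qbar.
have ad0 : 0 <= ad by exact: normr_ge0.
have dad : 0 <= dd + ad by have := ler_normlW (lexx `|- dd|); rewrite normrN -/ad; lra.
have dad' : 0 <= ad - dd by have := ler_norm dd; rewrite -/ad; lra.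
have kap0 q : 0 <= kap q.
  have := clamp_in ql_lt_qh q; rewrite in_itv/= => /andP[h _].
  exact: le_trans (ltW ql_gt0) h.
have mkap : measurable_fun setT kap by exact: measurable_clamp.
have mUk : measurable_fun setT (fun q => (U (kap q))%:E) by exact/measurable_EFinP.
have mUp : measurable_fun setT (fun q => (U (kap (pool I qbar q)))%:E).
  by apply/measurable_EFinP; exact: measurableT_comp U_meas mpool.

have uw q : I q -> u q <= w q.
  move=> Iq; have qI := Ik _ Iq; rewrite /u /w kap_id//.
  have [->|nq] := eqVneq q qbar; first by lra.
  have := concave qI qbarI nq; rewrite -/dd; lra.
have uw' q : I q -> q != qbar -> u q < w q.
  move=> Iq nq; have qI := Ik _ Iq; rewrite /u /w kap_id//.
  have := concave qI qbarI nq; rewrite -/dd; lra.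
have u0 q : 0 <= u q by rewrite /u !addr_ge0// mulr_ge0.
have Ubar0 : 0 <= U qbar by apply: U_ge0.
have bndI (J : set R) : measurable J -> (\int[mu]_(q in J) (U (kap q))%:E < +oo)%E.
  move=> mJ; apply: (@le_lt_trans _ _ (\int[mu]_(q in J) (cst B%:E q))%E).
    apply: ge0_le_integral => //.
    - by move=> q _; rewrite lee_fin.
    - exact: measurable_funTS.
    - by move=> q _; rewrite lee_fin U_le// clamp_in.
  rewrite integral_cst// -[X in (_ * X)%E]fineK ?fin_num_measure//.
  by rewrite -EFinM ltry.
pose N := fine (mu I); have NE : mu I = N%:E by rewrite /N fineK.
have ic (r : R) : (\int[mu]_(q in I) r%:E = (r * N)%:E)%E.
  by rewrite EFinM -NE; have := integral_cst mu mIm r%:E.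
rewrite NE -EFinM in qbarE.
(* Outside I pooling changes nothing and the integral is finite, so the comparison localizes to
   I. *)
have le_I : ((U qbar * N)%:E <= \int[mu]_(q in I) (U (kap q))%:E)%E.
  move: le_int; rewrite (ge0_integral_setC mu mIm mUp (fun q => Uk0 _)).
  rewrite (ge0_integral_setC mu mIm mUk (fun q => Uk0 _)).
  have -> : (\int[mu]_(q in ~` I) (U (kap (pool I qbar q)))%:E =
     \int[mu]_(q in ~` I) (U (kap q))%:E)%E.
    by apply: eq_integral => q /set_mem Iq; rewrite /pool memNset.
  rewrite leeD2rE; last first.
    rewrite ge0_fin_numE; first by apply: bndI; exact: measurableC.
    by apply: integral_ge0 => q _; rewrite lee_fin.
  have -> // : (\int[mu]_(q in I) (U (kap (pool I qbar q)))%:E = (U qbar * N)%:E)%E.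
  rewrite -ic; apply: eq_integral => q qI.
  by rewrite /pool qI kap_id.
have mu_ : measurable_fun setT u.
  apply: measurable_funD => //; apply: measurable_funD => //.
  exact: measurable_funM.
have mw_ : measurable_fun setT w.
  apply: measurable_funD => //; apply: measurable_funD => //.
  exact: measurable_funM.
have mkE : measurable_fun I (fun q => (kap q)%:E).
  by apply/measurable_EFinP; exact: measurable_funTS.
have intu : (\int[mu]_(q in I) (u q)%:E =
    \int[mu]_(q in I) (U (kap q))%:E + (2 * ad * qbar * N)%:E)%E.
  have -> : (\int[mu]_(q in I) (u q)%:E = \int[mu]_(q in I)
      ((U (kap q))%:E + (ad%:E * (kap q)%:E + (ad * qbar)%:E)))%E.
    by apply: eq_integral => q _; rewrite -EFinM -!EFinD addrA.
  rewrite ge0_integralD//; last 4 first.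
  - by move=> q _; rewrite lee_fin.
  - exact: measurable_funTS.
  - by move=> q _; rewrite adde_ge0// ?lee_fin mulr_ge0.
  - by apply: emeasurable_funD => //; exact: emeasurable_funM.
  rewrite ge0_integralD//; last 3 first.
  - by move=> q _; rewrite lee_fin mulr_ge0.
  - by apply: emeasurable_funM.
  - by move=> q _; rewrite lee_fin mulr_ge0.
  rewrite ge0_integralZl//; last by move=> q _; rewrite lee_fin.
  rewrite qbarE ic; congr (_ + _)%E.
  rewrite -EFinM -EFinD; congr (_%:E); ring.
have intw : (\int[mu]_(q in I) (w q)%:E =
    (U qbar * N)%:E + (2 * ad * qbar * N)%:E)%E.
  have -> : (\int[mu]_(q in I) (w q)%:E = \int[mu]_(q in I)
      ((dd + ad)%:E * (kap q)%:E + (U qbar + (ad - dd) * qbar)%:E))%E.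
    by apply: eq_integral => q _; rewrite -EFinM -!EFinD /w; congr (_%:E); ring.
  have k0 : 0 <= U qbar + (ad - dd) * qbar by rewrite addr_ge0// mulr_ge0.
  rewrite ge0_integralD//; last 2 first.
  - by move=> q _; rewrite lee_fin mulr_ge0.
  - by apply: emeasurable_funM.
  rewrite ge0_integralZl//; last by move=> q _; rewrite lee_fin.
  rewrite qbarE ic -EFinM -!EFinD; congr (_%:E); ring.
have null (J : set R) : measurable J -> J `<=` I -> ~ J qbar -> mu J = 0%E.
  move=> mJ JI Jq.
  apply: (@null_lt_of_le_integral _ _ _ mu I J u w) => //.
  - exact: measurable_funTS.
  - exact: measurable_funTS.
  - by move=> q Iq; rewrite u0 uw.
  - move=> q Jq'; apply: uw'; first exact: JI.
    by apply/eqP => E; apply: Jq; rewrite -E.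
  - by rewrite intu lte_add_pinfty ?bndI// ltry.
  - by rewrite intu intw leeD2r.
(* One open half of I avoids qbar, yet full support gives it positive mass. *)
pose mid := (q1 + q2) / 2.
have h1 : q1 < mid by rewrite /mid; have := q1_lt_q2; lra.
have h2 : mid < q2 by rewrite /mid; have := q1_lt_q2; lra.
have [qm|qm] := ltP qbar mid.
  have := @subinterval_measure_gt0 mid q2 (ltW h1) h2 (lexx _).
  rewrite null ?ltxx//; first by apply: subset_itvr; rewrite bnd_simp ltW.
  by rewrite /= in_itv/= => /andP[h _]; move: (lt_trans qm h); rewrite ltxx.
have := @subinterval_measure_gt0 q1 mid (lexx _) h1 (ltW h2).
rewrite null ?ltxx//; first by apply: subset_itvl; rewrite bnd_simp ltW.
by rewrite /= in_itv/= => /andP[_ h]; move: (le_lt_trans qm h); rewrite ltxx.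
Qed.

End concavity.

(** * The three implications *)

Section equivalence.
Context (R : realType) (ql qh c : R) (f p : R -> R) (mu : probability R R).
Local Notation leb := (@lebesgue_measure R).
Hypothesis c_gt0 : 0 < c.
Hypothesis c_lt_ql : c < ql.
Hypothesis ql_lt_qh : ql < qh.
Hypothesis f_gt0 : forall v : R, v \in `]0, 1[ -> 0 < f v.
Hypothesis f_total : (\int[leb]_(x in `[0%R, 1%R]) (f x)%:E)%E = 1%E.
Hypothesis f_der : forall v : R, v \in `]0, 1[ ->
  derivable f v 1 /\ derivable (derive1 f) v 1.
Hypothesis f_cont2 : {in `]0, 1[, continuous (derive1n 2 f)}.
Hypothesis psi_reg : forall v : R, v \in `]0, 1[ ->
  0 < virtual_val f v -> 0 < derive1 (virtual_val f) v.
Hypothesis p_opt : forall q : R, q \in `[ql, qh] -> forall p' : R, p' != p q ->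
  (p' - c) * (1 - dens_cdf f (p' / q)) < (p q - c) * (1 - dens_cdf f (p q / q)).
Hypothesis mu_supp : mu `[ql, qh]%classic = 1%E.
Hypothesis full_supp : forall x : R, x \in `[ql, qh] -> forall e : R, 0 < e ->
  (0 < mu `](x - e)%R, (x + e)%R[%classic)%E.
Local Notation U := (payoff_at f p).
Local Notation D := (payoff_slope f p).
Local Notation kap := (clamp ql qh).

Let ql_gt0 : 0 < ql. Proof. exact: lt_trans c_lt_ql. Qed.

Let lQ : ql \in `[ql, qh]. Proof. by rewrite in_itv/= lexx ltW. Qed.
Let hQ : qh \in `[ql, qh]. Proof. by rewrite in_itv/= lexx ltW. Qed.

Let exc_nd : {in `[ql, qh] &, {homo (fun q => excess f (p q / q)) : x y / x <= y}}.
Proof. exact: (@excess_norm_price_nondecreasing R ql qh c). Qed.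

Let U_ge0 t : t \in `[ql, qh] -> 0 <= U t.
Proof. exact: (@payoff_at_ge0 R ql qh c). Qed.

Let U_meas : measurable_fun setT (U \o kap).
Proof.
apply: measurable_funM; first exact: measurable_clamp.
exact: (measurable_clamp_comp ql_lt_qh exc_nd).
Qed.

Let U_le t : t \in `[ql, qh] -> U t <= qh * excess f (p qh / qh).
Proof.
move=> tQ; have := tQ; rewrite in_itv/= => /andP[lt th].
have t0 : 0 < t by exact: lt_le_trans lt.
have e0 : 0 <= excess f (p t / t).
  by have := U_ge0 tQ; rewrite /U pmulr_rge0.
rewrite /U ler_pM// ?(ltW t0)//; exact: exc_nd.
Qed.

Lemma buyer_payoffE (d : measure_display) (X : measurableType d)
    (pi : R -> probability X R) (m : X -> R) (nu : giry X R) :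
  is_info_kernel pi -> is_posterior_mean mu pi m ->
  (forall h : X -> \bar R, measurable_fun setT h -> (forall x, 0 <= h x)%E ->
    \int[nu]_x h x = \int[mu]_q \int[pi q]_x h x)%E ->
  buyer_payoff mu pi m f p = (\int[nu]_x (U (kap (m x)))%:E)%E.
Proof.
move=> kpi pm nuE.
apply: (posterior_payoff ql_gt0 ql_lt_qh mu_supp kpi nuE pm (gc := EFin \o U)).
- by move=> t tQ; exact: (@buyer_utilE R ql qh c).
- exact/measurable_EFinP.
- by move=> t /=; rewrite lee_fin U_ge0// clamp_in.
Qed.

Lemma buyer_payoff_dirac (s : R -> R) : measurable_fun setT s ->
  is_posterior_mean mu (fun q => (dirac (s q) : probability R R)) id ->
  buyer_payoff mu (fun q => (dirac (s q) : probability R R)) id f p =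
  (\int[mu]_q (U (kap (s q)))%:E)%E.
Proof.
move=> ms pm; have ker := dirac_kernel ms.
have [nu nuE] := signal_law mu ker.
have mU : measurable_fun setT (fun x => (U (kap x))%:E) by exact/measurable_EFinP.
rewrite (buyer_payoffE ker pm nuE) nuE//; last first.
  by move=> x; rewrite lee_fin U_ge0// clamp_in.
by apply: eq_integral => q _; rewrite integral_dirac// diracT mul1e.
Qed.

Lemma monotone_of_cond :
  (forall v, p qh / qh < v < p ql / ql ->
    inv_hazard f v * derive1n 2 (inv_hazard f) v + derive1 (inv_hazard f) v <= 1) ->
  forall (d : measure_display) (X : measurableType d) (pi : R -> probability X R)
    (d' : measure_display) (X' : measurableType d') (pi' : R -> probability X' R)
    (m : X -> R) (m' : X' -> R),
  is_info_kernel pi -> is_info_kernel pi' -> more_informative ql qh pi' pi ->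
  is_posterior_mean mu pi m -> is_posterior_mean mu pi' m' ->
  (buyer_payoff mu pi m f p <= buyer_payoff mu pi' m' f p)%E.
Proof.
move=> cond d X pi d' X' pi' m m' kpi kpi' [g [mg gE]] pm pm'.
have cvx := payoff_convex c_gt0 c_lt_ql ql_lt_qh f_gt0 f_total f_der psi_reg p_opt cond.
have D_nd := payoff_slope_nondecreasing cvx.
have [nu nuE] := signal_law mu kpi.
have [nu' nuE'] := signal_law mu kpi'.
rewrite (buyer_payoffE kpi pm nuE) (buyer_payoffE kpi' pm' nuE').
have mm : measurable_fun setT m by case: pm.
have mm' : measurable_fun setT m' by case: pm'.
have mk : measurable_fun setT kap by exact: measurable_clamp.
(* D is nondecreasing, hence between D ql and D qh; adding |D ql| makes it nonnegative and bounded
   by D qh + |D ql|. *)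
apply: (@kernel_jensen _ _ _ _ _ nu nu' g (kap \o m) (kap \o m') U D ql qh
  (D qh + `|D ql|) `|D ql|) => //.
- exact: measurableT_comp mk mm.
- exact: measurableT_comp mk mm'.
- exact: measurableT_comp U_meas mm.
- exact: measurableT_comp U_meas mm'.
- exact: measurableT_comp (measurable_clamp_comp ql_lt_qh D_nd) mm.
- exact: ltW.
- by move=> x; exact: clamp_in.
- by move=> x; exact: clamp_in.
- move=> t tQ; have := tQ; rewrite in_itv/= => /andP[lt th].
  have h1 := D_nd _ _ lQ tQ lt; have h2 := D_nd _ _ tQ hQ th.
  have h3 := ler_norm (- D ql); rewrite normrN in h3.
  by apply/andP; split; lra.
- exact: (garbling_integral mu_supp nuE nuE' mg gE).
- exact: (garbling_posterior_integral ql_gt0 ql_lt_qh mu_supp kpi kpi' pm pm' nuE nuE' mg gE).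
Qed.

(** Full revelation is pooling over the empty set, with ql as a dummy pooled value. *)
Lemma full_revelation_posterior_mean : is_posterior_mean mu (@full_revelation R) id.
Proof.
have E : (\int[mu]_(q in set0) (kap q)%:E = ql%:E * mu set0)%E.
  by rewrite integral_set0 measure0 mule0.
have := pool_posterior_mean ql_gt0 ql_lt_qh mu_supp measurable0 lQ E.
rewrite (_ : (fun q => _) = @full_revelation R)//.
by apply/funext => q; rewrite /pool in_set0.
Qed.

Lemma cond_of_optimal :
  (forall (d : measure_display) (X : measurableType d) (pi : R -> probability X R)
      (m : X -> R) (mF : R -> R),
    is_info_kernel pi -> is_posterior_mean mu pi m ->
    is_posterior_mean mu (@full_revelation R) mF ->
    (buyer_payoff mu pi m f p <= buyer_payoff mu (@full_revelation R) mF f p)%E) ->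
  forall v, p qh / qh < v < p ql / ql ->
    inv_hazard f v * derive1n 2 (inv_hazard f) v + derive1 (inv_hazard f) v <= 1.
Proof.
move=> opt v vI; rewrite leNgt; apply/negP => cond.
have [q1 [q2 [lq1 q12 q2h conc]]] := payoff_strictly_concave c_gt0 c_lt_ql
  ql_lt_qh f_gt0 f_total f_der f_cont2 psi_reg p_opt vI cond.
have [qbar qbarI qbarE] := pooled_mean_exists ql_gt0 q12 lq1 q2h full_supp.
have qbarQ : qbar \in `[ql, qh].
  move: qbarI; rewrite !in_itv/= => /andP[h1 h2].
  by rewrite (le_trans lq1)// (le_trans h2).
have mI : measurable (`]q1, q2[%classic : set R) by [].
have ms := measurable_pool qbar mI.
have pm := pool_posterior_mean ql_gt0 ql_lt_qh mu_supp mI qbarQ qbarE.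
apply: (pooling_improves ql_gt0 ql_lt_qh q12 lq1 q2h full_supp U_ge0 U_le U_meas
  conc qbarI qbarE).
have := opt _ _ _ _ _ (dirac_kernel ms) pm full_revelation_posterior_mean.
rewrite (buyer_payoff_dirac ms pm).
by rewrite (buyer_payoff_dirac (@measurable_id _ _ setT) full_revelation_posterior_mean).
Qed.

Lemma optimal_of_monotone :
  (forall (d : measure_display) (X : measurableType d) (pi : R -> probability X R)
    (d' : measure_display) (X' : measurableType d') (pi' : R -> probability X' R)
    (m : X -> R) (m' : X' -> R),
    is_info_kernel pi -> is_info_kernel pi' -> more_informative ql qh pi' pi ->
    is_posterior_mean mu pi m -> is_posterior_mean mu pi' m' ->
    (buyer_payoff mu pi m f p <= buyer_payoff mu pi' m' f p)%E) ->
  forall (d : measure_display) (X : measurableType d) (pi : R -> probability X R)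
      (m : X -> R) (mF : R -> R),
    is_info_kernel pi -> is_posterior_mean mu pi m ->
    is_posterior_mean mu (@full_revelation R) mF ->
    (buyer_payoff mu pi m f p <= buyer_payoff mu (@full_revelation R) mF f p)%E.
Proof.
move=> mono d X pi m mF kpi pm pmF; apply: mono => //.
  exact: (dirac_kernel (@measurable_id _ _ setT)).
(* The garbling kernel is pi itself: the revealing signal is q, and x is then drawn from pi q. *)
exists pi; split=> [A mA|q _ A mA]; first exact: kpi.
rewrite integral_dirac ?diracT ?mul1e//; exact: kpi.
Qed.

End equivalence.

Unset Implicit Arguments.

Theorem theorem1 (R : realType) (ql qh c : R) (f : R -> R) (p : R -> R)
    (mu : probability R R) :
  0 < ql -> ql < qh -> 0 < c -> c < ql ->
  (* F has support [0,1] and a C^2 positive density f on (0,1) *)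
  (forall v, v \in `]0, 1[ -> 0 < f v) ->
  (\int[@lebesgue_measure R]_(x in `[0%R, 1%R]) (f x)%:E)%E = 1%E ->
  (forall v, v \in `]0, 1[ -> derivable f v 1 /\ derivable (derive1 f) v 1) ->
  {in `]0, 1[, continuous (derive1n 2 f)} ->
  (* psi' > 0 whenever psi > 0 *)
  (forall v, v \in `]0, 1[ -> 0 < virtual_val f v -> 0 < derive1 (virtual_val f) v) ->
  (* p(q) is the unique maximizer of (p - c)(1 - F(p/q)) *)
  (forall q, q \in `[ql, qh] -> forall p', p' != p q ->
     (p' - c) * (1 - dens_cdf f (p' / q)) < (p q - c) * (1 - dens_cdf f (p q / q))) ->
  (* prior mu on Q with support Q *)
  mu `[ql, qh]%classic = 1%E ->
  (forall x, x \in `[ql, qh] -> forall e : R, 0 < e ->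
     (0 < mu `](x - e)%R, (x + e)%R[%classic)%E) ->
  let r := inv_hazard f in
  let pbar := fun q => p q / q in
  [/\
   (* (1) <-> (2) *)
   ((forall (d : measure_display) (X : measurableType d) (pi : R -> probability X R)
        (d' : measure_display) (X' : measurableType d') (pi' : R -> probability X' R)
        (m : X -> R) (m' : X' -> R),
       is_info_kernel pi -> is_info_kernel pi' ->
       more_informative ql qh pi' pi ->
       is_posterior_mean mu pi m -> is_posterior_mean mu pi' m' ->
       (buyer_payoff mu pi m f p <= buyer_payoff mu pi' m' f p)%E)
    <->
    (forall (d : measure_display) (X : measurableType d) (pi : R -> probability X R)
        (m : X -> R) (mF : R -> R),
       is_info_kernel pi ->
       is_posterior_mean mu pi m -> is_posterior_mean mu (@full_revelation R) mF ->
       (buyer_payoff mu pi m f p <= buyer_payoff mu (@full_revelation R) mF f p)%E)),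
   (* (2) <-> (3) *)
   ((forall (d : measure_display) (X : measurableType d) (pi : R -> probability X R)
        (m : X -> R) (mF : R -> R),
       is_info_kernel pi ->
       is_posterior_mean mu pi m -> is_posterior_mean mu (@full_revelation R) mF ->
       (buyer_payoff mu pi m f p <= buyer_payoff mu (@full_revelation R) mF f p)%E)
    <->
    (forall v, pbar qh < v < pbar ql -> r v * derive1n 2 r v + derive1 r v <= 1))
   &
   (* (1) <-> (3) *)
   ((forall (d : measure_display) (X : measurableType d) (pi : R -> probability X R)
        (d' : measure_display) (X' : measurableType d') (pi' : R -> probability X' R)
        (m : X -> R) (m' : X' -> R),
       is_info_kernel pi -> is_info_kernel pi' ->
       more_informative ql qh pi' pi ->
       is_posterior_mean mu pi m -> is_posterior_mean mu pi' m' ->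
       (buyer_payoff mu pi m f p <= buyer_payoff mu pi' m' f p)%E)
    <->
    (forall v, pbar qh < v < pbar ql -> r v * derive1n 2 r v + derive1 r v <= 1))].
Proof.
move=> ql_gt0 ql_lt_qh c_gt0 c_lt_ql f_gt0 f_total f_der f_cont2 psi_reg p_opt.
move=> mu_supp full_supp r pbar.
have h12 := @optimal_of_monotone R ql qh f p mu.
have h23 := cond_of_optimal c_gt0 c_lt_ql ql_lt_qh f_gt0 f_total f_der f_cont2
  psi_reg p_opt mu_supp full_supp.
have h31 := monotone_of_cond c_gt0 c_lt_ql ql_lt_qh f_gt0 f_total f_der
  psi_reg p_opt mu_supp.
split; split.
- exact: h12.
- by move=> /h23/h31.
- exact: h23.
- by move=> /h31/h12.
- by move=> /h12/h23.
- exact: h31.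
Qed.
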